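(* Let $d\ge2$ and let $f(x)=e^{-m|x|}g(|x|)$ be a density on $\mathbb{R}^d$ satisfying assumption (B), with constant $C_3\ge1$ in (B)(b). Then $$g_n(x)\ge M_4^{\,n-1}G_n(|x|),\qquad x\in\mathbb{R}^d,\ n\ge1,$$ with $$M_4:=1\wedge\left(\frac{2^{d-1}}{C_3\,\pi^{\frac{d-3}{2}}\,\Gamma\left(\frac{d-1}{2}\right)}\right).$$
   Context: $\mathbb{N}=\{1,2,\dots\}$, $a\wedge b=\min(a,b)$; $|x|$ is the Euclidean norm. A density is a nonnegative nonzero function in $L^1(\mathbb{R}^d)$ (Lebesgue measure). ''Decreasing'' is meant in the non-strict sense. Assumption (B): $f$ is a density of the form $f(x)=e^{-m|x|}g(|x|)$, where $m>0$ and $g:[0,\infty)\to(0,\infty]$ is such that (a) $g$ is a decreasing function; (b) there is a constant $C_3\ge1$ such that $g(r)\le C_3g(2r)$ for $r>0$. Functions $g_n$ (not to be confused with the profile $g$): $g_1\equiv1$ on $\mathbb{R}^d$ and, for $n\in\mathbb{N}$, $$g_{n+1}(x):=\frac{\int_{E(x)}f(x-y)f(y)g_n(y)\,dy}{f(x)},\qquad E(x)=\{z\in\mathbb{R}^d:|z|<|x|,\ |x-z|<|x|\}.$$ An integral over the empty set equals $0$ and $a/(+\infty)=0$ for $a\ge0$. Functions $G_n$ (for $d\ge2$): $G_1\equiv1$ on $[0,\infty)$ and, for $n\in\mathbb{N}$, $G_{n+1}(0)=0$ and, for $r>0$, $$G_{n+1}(r):=\frac{1}{g(r)\,r^{\frac{d-1}{2}}}\int_0^r\left(\int_0^{\sqrt{\rho\wedge(r-\rho)}}e^{-ms^2}s^{d-2}\,ds\right)g(r-\rho)(r-\rho)^{\frac{d-1}{2}}g(\rho)\rho^{\frac{d-1}{2}}G_n(\rho)\,d\rho.$$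 *)

(* Defs.v *)
From HB Require Import structures.
From mathcomp Require Import all_boot all_order all_algebra.
From mathcomp Require Import all_classical all_reals all_analysis.

Set Implicit Arguments.
Unset Strict Implicit.
Unset Printing Implicit Defensive.

Import Order.TTheory GRing.Theory Num.Theory.
Import numFieldNormedType.Exports.

Local Open Scope classical_set_scope.
Local Open Scope ring_scope.

(* [Rn R n] is R^n with the Borel sigma-algebra that the library puts on
   tuples (the one generated by the coordinates). *)
Notation Rn R n := (n.-tuple (measurableTypeR R)).

(* Lebesgue measure on R^n, by iterating the product with [lebesgue_measure]
   through the identification of R^(n+1) with R * R^n; [leb_box] below shows
   that the measure of a box is the product of the lengths of its sides. *)
Section lebesgue_tuple.
Context {R : realType}.

Definition cons_pair n (p : measurableTypeR R * Rn R n) : Rn R n.+1 :=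
  [the n.+1.-tuple _ of p.1 :: p.2].

Lemma measurable_cons_pair n : measurable_fun setT (@cons_pair n).
Proof.
exact: (@measurable_cons _ _ _ (measurableTypeR R) fst n snd
  measurable_fst measurable_snd).
Qed.

Section step.
Variables (n : nat) (mu : {sigma_finite_measure set (Rn R n) -> \bar R}).

Definition leb_step : set (Rn R n.+1) -> \bar R :=
  pushforward (lebesgue_measure \x mu)%E (@cons_pair n).

Let leb_step0 : leb_step set0 = 0%E.
Proof. by rewrite /leb_step /pushforward preimage_set0 measure0. Qed.

Let leb_step_ge0 A : (0 <= leb_step A)%E.
Proof. exact: (measure_ge0 (lebesgue_measure \x mu)%E). Qed.

Let leb_step_sigma_additive : semi_sigma_additive leb_step.
Proof.
move=> F mF tF mUF; rewrite /leb_step /pushforward preimage_bigcup.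
have mc A : measurable A -> measurable (@cons_pair n @^-1` A).
  by move=> mA; rewrite -[X in measurable X]setTI; exact: measurable_cons_pair.
apply: measure_semi_sigma_additive.
- by move=> k; exact: mc.
- apply/trivIsetP => /= i j _ _ ij; rewrite -preimage_setI.
  by move/trivIsetP : tF => /(_ _ _ _ _ ij) ->//; rewrite preimage_set0.
- by rewrite -preimage_bigcup; exact: mc.
Qed.

HB.instance Definition _ := isMeasure.Build _ _ _ leb_step
  leb_step0 leb_step_ge0 leb_step_sigma_additive.

Let leb_step_sigma_finite : sigma_finite setT leb_step.
Proof.
have /sigma_finiteP[F [TF ndF Foo]] := sigma_finiteT (@lebesgue_measure R).
have /sigma_finiteP[G [TG ndG Goo]] := sigma_finiteT mu.
pose s (t : Rn R n.+1) : measurableTypeR R * Rn R n :=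
  (tnth t ord0, [tuple of behead t]).
have ms : measurable_fun setT s.
  apply/measurable_fun_pairP; split.
    exact: (@measurable_tnth _ (measurableTypeR R) n.+1 ord0).
  exact: (@measurable_behead _ (measurableTypeR R) n).
have sK : cancel (@cons_pair n) s.
  by move=> [x t]; rewrite /s; congr pair; exact/val_inj.
exists (fun k => s @^-1` (F k `*` G k)).
  apply/esym/seteqP; split => // t _.
  have [i _ Fi] : (\bigcup_k F k) (s t).1 by rewrite -TF.
  have [j _ Gj] : (\bigcup_k G k) (s t).2 by rewrite -TG.
  exists (maxn i j) => //; split => /=.
    by move: Fi; exact/subsetPset/ndF/leq_maxl.
  by move: Gj; exact/subsetPset/ndG/leq_maxr.
move=> k; have [mF Fk] := Foo k; have [mG Gk] := Goo k; split.
  by rewrite -[X in measurable X]setTI; apply: ms => //; exact: measurableX.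
rewrite /leb_step /pushforward (_ : _ @^-1` _ = F k `*` G k).
  by rewrite product_measure1E// lte_mul_pinfty// ge0_fin_numE.
by rewrite -comp_preimage (_ : s \o _ = id)//; exact/funext/sK.
Qed.

HB.instance Definition _ := Measure_isSigmaFinite.Build _ _ _ leb_step
  leb_step_sigma_finite.

End step.

Fixpoint leb (n : nat) : {sigma_finite_measure set (Rn R n) -> \bar R} :=
  match n return {sigma_finite_measure set (Rn R n) -> \bar R} with
  | 0 => dirac ([tuple] : Rn R 0)
  | k.+1 => leb_step (leb k)
  end.

Lemma leb_box n (a b : 'I_n -> R) : (forall i, a i <= b i) ->
  leb n [set x | forall i, a i <= tnth x i <= b i] =
  (\prod_(i < n) (b i - a i))%:E.
Proof.
elim: n a b => [|n IH] a b ab.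
  rewrite big_ord0 /= diracE mem_set//= => -[]//.
pose A : set (Rn R n) :=
  [set x | forall i, a (lift ord0 i) <= tnth x i <= b (lift ord0 i)].
have mA : measurable A.
  rewrite (_ : A = \bigcap_(i in [set: 'I_n]) ((fun x : Rn R n => tnth x i) @^-1`
      `[a (lift ord0 i), b (lift ord0 i)])).
    apply: fin_bigcap_measurable => // i _; rewrite -[X in measurable X]setTI.
    exact: (@measurable_tnth _ (measurableTypeR R)).
  by apply/seteqP; split => x /= Ax i //=; [move=> _|];
    have := Ax i; rewrite /= in_itv//=; exact.
rewrite big_ord_recl EFinM -(IH (a \o lift ord0) (b \o lift ord0)) //=.
rewrite /leb_step /pushforward.
rewrite (_ : _ @^-1` _ = `[a ord0, b ord0] `*` A); last first.
  apply/seteqP; split => [[x t]|[x t] [/=]] /=.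
    move=> H; split => [|i] /=; first by have := H ord0; rewrite in_itv.
    by have := H (lift ord0 i); rewrite tnthS.
  rewrite in_itv /= => xab tA i.
  by have [j ->|->] := unliftP ord0 i; rewrite ?tnthS.
rewrite product_measure1E//=; congr (_ * _)%E.
by rewrite lebesgue_measure_itv /= lte_fin; case: ltP (ab ord0) => // ba ab0;
  rewrite (le_anti (introT andP (conj ab0 ba))) ?subrr.
Qed.

End lebesgue_tuple.

Section euclidean.
Context {R : realType}.

Definition enorm n (x : Rn R n) : R := Num.sqrt (\sum_(i < n) tnth x i ^+ 2).

Definition tsub n (x y : Rn R n) : Rn R n := [tuple tnth x i - tnth y i | i < n].

Definition density n (f : Rn R n -> \bar R) : Prop :=
  [/\ (leb n).-integrable setT f,
      (forall x, 0 <= f x)%E &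
      ~ {ae leb n, forall x, f x = 0%E}].

(* Only the restriction of the profile [g] to [0, +oo[ is relevant. *)
Definition assumptionB n (f : Rn R n -> \bar R) (m : R) (g : R -> \bar R)
    (C3 : R) : Prop :=
  density f /\
  (forall x, f x = (expR (- m * enorm x))%:E * g (enorm x))%E /\
  0 < m /\
  (forall r : R, 0 <= r -> (0 < g r)%E) /\
  (forall r s : R, 0 <= r -> r <= s -> (g s <= g r)%E) /\
  1 <= C3 /\
  (forall r : R, 0 < r -> (g r <= C3%:E * g (2 * r)%R)%E).

Definition lens n (x : Rn R n) : set (Rn R n) :=
  [set z | enorm z < enorm x /\ enorm (tsub x z) < enorm x].

(* The sequence starts at index 1; the value at index 0 is a dummy.
   Division in [\bar R] satisfies a / +oo = 0. *)
Fixpoint g_ d (f : Rn R d -> \bar R) (n : nat) (x : Rn R d) : \bar R :=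
  match n with
  | 0 => 1%E
  | k.+1 => if k is 0 then 1%E else
      ((\int[leb d]_(y in lens x) (f (tsub x y) * f y * g_ f k y)) / f x)%E
  end.

(* The exponent d - 2 is truncated: meaningful only for 2 <= d. *)
Definition inner_int (d : nat) (m u : R) : \bar R :=
  (\int[lebesgue_measure]_(s in `[0%R, Num.sqrt u])
     (expR (- m * s ^+ 2) * s ^+ (d - 2))%:E)%E.

Definition halfpow (d : nat) (r : R) : R := r `^ ((d%:R - 1) / 2).

(* As for [g_], the value at index 0 is a dummy. The outer integral is taken
   over the open interval because [g 0] may be +oo. *)
Fixpoint G_ (d : nat) (m : R) (g : R -> \bar R) (n : nat) (r : R) : \bar R :=
  match n with
  | 0 => 1%E
  | k.+1 => if k is 0 then 1%E else if r == 0 then 0%E else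
      ((\int[lebesgue_measure]_(rho in `]0%R, r[)
         (inner_int d m (Num.min rho (r - rho))%R *
          (g (r - rho)%R * (halfpow d (r - rho)%R)%:E) *
          (g rho * (halfpow d rho)%:E) * G_ d m g k rho))
       / (g r * (halfpow d r)%:E))%E
  end.

(* Euler's Gamma function, for 0 < a. *)
Definition Gamma (a : R) : R :=
  \int[lebesgue_measure]_(t in `]0%R, +oo[) (t `^ (a - 1) * expR (- t)).

Definition M4 (d : nat) (C3 : R) : R :=
  Num.min 1 (2 ^+ (d - 1) /
    (C3 * pi `^ ((d%:R - 3) / 2) * Gamma ((d%:R - 1) / 2))).

End euclidean.

(* Main.v *)
From HB Require Import structures.
Require Import Defs.
From mathcomp Require Import all_boot all_order all_algebra.
From mathcomp Require Import all_classical all_reals all_analysis.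
From mathcomp Require Import measurable_realfun lra ring.

(** Fix [x] with [r = |x| > 0] and put [k = d - 1]. Once [g_ n y] is bounded
    below by a multiple of [G_ n |y|], the integrand of the recursion for
    [g_ n.+1 x] depends on [y] only through [|y|] and [|x - y|]. The theorem
    follows from a lower bound, with an explicit constant, for the integral of
    such a bipolar function.

    A reflection carries [x] to the first axis. Write [y = (t, w)] with [t] real
    and [w] in R^k. In [w] the integrand is radial, so integrating over [w]
    amounts to integrating [c * s^(k-1) ds] over [s = |w| > 0], where
    [c = 2 pi^(k/2) / Gamma(k/2)] ([exists_radial_constant]). For fixed [s], the
    change of variable from [t > 0] to [rho = sqrt(t^2 + s^2)] contracts lengths,
    so replacing [dt] by [d rho] only makes the integral smaller
    ([le_integral_hypotenuse]). This is [exists_bipolar_constant].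

    For fixed [rho] in ]0, r[, put [s = beta * u] with
    [beta^2 = rho (r - rho) / r], and let [D = |x - y|]. When
    [u^2 <= min(rho, r - rho)], elementary geometry ([far_dist_bounds]) gives
    three facts. First, [D < r], so [y] lies in the lens. Second,
    [D <= 2 (r - rho)], so [g D >= g (r - rho) / C3] by monotonicity and
    doubling. Third, [D + rho - r <= u^2], so the exponential factor is at least
    [e^(- m r) e^(- m u^2)]. The integral in [u] is then the inner integral in
    the definition of [G_], and the Jacobian [beta^k] produces the powers
    [(d - 1) / 2] of [rho], [r - rho] and [r] ([slice_lower_bound]). Hence one
    step of the recursion for [g_] dominates [c / C3] times one step of the
    recursion for [G_] ([exists_step_constant]); [M4 <= c / C3] because
    [pi >= 2] ([M4_le]), and induction on [n] concludes.

    Two facts about Lebesgue measure are obtained from uniqueness principles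
    instead of determinants and Jacobians: invariance under reflections follows
    from invariance under translations ([integral_leb_isometry]), and
    integration in polar form follows from behaviour under dilations
    ([polar_integration]). *)

Import Order.TTheory GRing.Theory Num.Theory.
Import numFieldNormedType.Exports.
Set Implicit Arguments.
Unset Strict Implicit.
Unset Printing Implicit Defensive.
Local Open Scope classical_set_scope.
Local Open Scope ring_scope.

(** * Integrals over the real line *)
Section integral_tools.
Local Open Scope ereal_scope.
Import HBNNSimple.

(** The integral of a nonnegative function is a supremum over the simple
    functions below it, so monotonicity holds for arbitrary functions, in
    particular for integrands containing [g_ n]. *)
Lemma ge0_le_integral_nonmeas d (T : measurableType d) (R : realType)
    (mu : {measure set T -> \bar R}) (D : set T) (f g : T -> \bar R) :
  (forall x, D x -> 0 <= f x) -> (forall x, D x -> f x <= g x) ->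
  \int[mu]_(x in D) f x <= \int[mu]_(x in D) g x.
Proof.
move=> f0 fg; have g0 x : D x -> 0 <= g x.
  by move=> Dx; exact: le_trans (f0 _ Dx) (fg _ Dx).
rewrite !ge0_integralE//; apply: ereal_sup_le => _ [h hf <-]; exists h => // x.
by apply: le_trans (hf x) _; exact: lee_restrict.
Qed.

Context {R : realType}.
Implicit Types phi : R -> \bar R.
Local Notation lam := (@lebesgue_measure R).

Lemma lebesgue_integral_translate (c : R) phi :
  measurable_fun setT phi -> (forall t, 0 <= phi t) ->
  \int[lam]_t phi (c + t)%R = \int[lam]_t phi t.
Proof.
move=> mphi phi0.
pose T : R -> R := fun t => (c + t)%R.
have mT : measurable_fun [set: measurableTypeR R] (T : _ -> measurableTypeR R).
  exact: measurable_funD.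
transitivity (\int[pushforward lam (T : _ -> measurableTypeR R)]_t phi t).
  by rewrite ge0_integral_pushforward.
apply: eq_measure_integral => A mA _; apply/esym.
apply: (lebesgue_measure_unique (mu := pushforward lam (T : measurableTypeR R -> measurableTypeR R))) => // _ [[a b] /= _ <-].
rewrite /pushforward (_ : T @^-1` _ = `](a - c)%R, (b - c)%R]%classic); last first.
  by apply/seteqP; split => x /=; rewrite /T !in_itv/= ltrBlDl lerBrDl.
rewrite !lebesgue_measure_itv/= !lte_fin ltrD2r; case: ifP => // _.
by rewrite -!EFinD; congr EFin; ring.
Qed.

(** Both this lemma and the previous one compare, on half-open intervals, two
    measures that are determined by their values there. *)
Lemma lebesgue_integral_dilate (s : R) phi : (0 < s)%R ->
  measurable_fun setT phi -> (forall t, 0 <= phi t) ->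
  \int[lam]_t phi (s * t)%R = s^-1%:E * \int[lam]_t phi t.
Proof.
move=> s0 mphi phi0.
pose T : R -> R := fun t => (s * t)%R.
have mT : measurable_fun [set: measurableTypeR R] (T : _ -> measurableTypeR R).
  exact: measurable_funM.
have sV0 : (0 <= s^-1)%R by rewrite invr_ge0 ltW.
transitivity (\int[pushforward lam (T : _ -> measurableTypeR R)]_t phi t).
  by rewrite ge0_integral_pushforward.
have -> : s^-1%:E = (NngNum sV0)%:num%:E by [].
rewrite -ge0_integral_mscale//.
apply: eq_measure_integral => A mA _.
have E : lam A = mscale (NngNum (ltW s0)) (pushforward lam (T : measurableTypeR R -> measurableTypeR R)) A.
  move=> ?; apply: lebesgue_measure_unique => // _ [[a b] /= _ <-].
  rewrite /mscale/= /pushforward (_ : T @^-1` _ = `](a / s)%R, (b / s)%R]%classic); last first.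
    apply/seteqP; split => x /=; rewrite /T !in_itv/=;
      by rewrite ltr_pdivrMr// ler_pdivlMr// ![(x * s)%R]mulrC.
  rewrite !lebesgue_measure_itv/= !lte_fin ltr_pM2r ?invr_gt0//.
  case: ifP => _; last by rewrite mule0.
  rewrite -!EFinD -EFinM; congr EFin; field; exact: lt0r_neq0.
move: (E mT); rewrite /mscale/= => EA.
rewrite [RHS](_ : _ = s^-1%:E * lam A)// EA muleA -EFinM mulVf ?mul1e//.
exact: lt0r_neq0.
Qed.

End integral_tools.

(** * Lebesgue measure on R^n: translations, dilations, Gaussian integral *)
Section euclidean_space.
Context {R : realType}.
Local Notation lam := (@lebesgue_measure R).

Definition vadd n (x y : Rn R n) : Rn R n := [tuple tnth x i + tnth y i | i < n].

Definition vscale n (s : R) (x : Rn R n) : Rn R n := [tuple s * tnth x i | i < n].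

Definition vdot n (x y : Rn R n) : R := \sum_(i < n) tnth x i * tnth y i.

Lemma measurable_sqrt : measurable_fun [set: R] (@Num.sqrt R).
Proof. by apply: continuous_measurable_fun; exact: sqrt_continuous. Qed.

Lemma measurable_coord n (i : 'I_n) : measurable_fun setT (fun y : Rn R n => tnth y i).
Proof. exact: (@measurable_tnth _ (measurableTypeR R)). Qed.

Lemma measurable_mktuple d (T : measurableType d) n (F : 'I_n -> T -> R) :
  (forall i, measurable_fun setT (F i)) ->
  measurable_fun setT (fun t => [tuple F i t | i < n] : Rn R n).
Proof.
move=> mF; apply/(@measurable_fun_tnthP _ _ _ (measurableTypeR R)) => i.
rewrite [X in measurable_fun _ X](_ : _ = F i); first exact: mF.
by apply/funext => t /=; rewrite tnth_mktuple.
Qed.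

Lemma measurable_vadd n (x : Rn R n) : measurable_fun setT (vadd x).
Proof.
apply: measurable_mktuple => i; apply: measurable_funD => //; exact: measurable_coord.
Qed.

Lemma measurable_vscale n (s : R) : measurable_fun setT (@vscale n s).
Proof.
by apply: measurable_mktuple => i; apply: measurable_funM => //; exact: measurable_coord.
Qed.

Lemma measurable_tsub n (x : Rn R n) : measurable_fun setT (tsub x).
Proof.
by apply: measurable_mktuple => i; apply: measurable_funB => //; exact: measurable_coord.
Qed.

Lemma measurable_enorm n : measurable_fun setT (@enorm R n).
Proof.
apply: (measurableT_comp measurable_sqrt).
by apply: measurable_sum => i; apply: measurable_funX; exact: measurable_coord.
Qed.

Lemma enorm_ge0 n (x : Rn R n) : 0 <= enorm x.
Proof. exact: sqrtr_ge0. Qed.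

Lemma enorm_sqr n (x : Rn R n) : enorm x ^+ 2 = vdot x x.
Proof.
rewrite sqr_sqrtr; last by apply: sumr_ge0 => i _; exact: sqr_ge0.
by apply: eq_bigr => i _; rewrite expr2.
Qed.

Lemma enorm_scale n s (x : Rn R n) : 0 <= s -> enorm (vscale s x) = s * enorm x.
Proof.
move=> s0; rewrite /enorm -[in RHS](ger0_norm s0) -sqrtr_sqr.
rewrite -sqrtrM ?sqr_ge0// mulr_sumr; congr Num.sqrt.
by apply: eq_bigr => i _; rewrite tnth_mktuple exprMn.
Qed.

Lemma enorm_cons n (t : R) (w : Rn R n) :
  enorm (cons_pair (t, w)) = Num.sqrt (t ^+ 2 + enorm w ^+ 2).
Proof.
rewrite enorm_sqr /enorm big_ord_recl; congr (Num.sqrt (_ + _)).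
by apply: eq_bigr => i _; rewrite /cons_pair tnthS expr2.
Qed.

Lemma vadd_cons n (a b : R) (v w : Rn R n) :
  vadd (cons_pair (a, v)) (cons_pair (b, w)) = cons_pair (a + b, vadd v w).
Proof.
apply: eq_from_tnth => i; rewrite tnth_mktuple.
by have [j ->|->] := unliftP ord0 i; rewrite ?tnthS ?tnth_mktuple ?tnth0.
Qed.

Lemma vscale_cons n (s t : R) (w : Rn R n) :
  vscale s (cons_pair (t, w)) = cons_pair (s * t, vscale s w).
Proof.
apply: eq_from_tnth => i; rewrite tnth_mktuple.
by have [j ->|->] := unliftP ord0 i; rewrite ?tnthS ?tnth_mktuple ?tnth0.
Qed.

Lemma cons_pair_eta n (x : Rn R n.+1) :
  exists t (w : Rn R n), x = cons_pair (t, w).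
Proof.
exists (tnth x ord0), [tuple of behead x]; apply: eq_from_tnth => i.
have [j ->|->] := unliftP ord0 i; rewrite ?tnthS ?tnth0//.
by rewrite tnth_behead; congr tnth; apply/val_inj; rewrite /= inordK// ltnS.
Qed.

Local Open Scope ereal_scope.

Lemma integral_leb_cons n (phi : Rn R n.+1 -> \bar R) :
  measurable_fun setT phi -> (forall y, 0 <= phi y) ->
  \int[leb n.+1]_y phi y = \int[lam]_t \int[leb n]_w phi (cons_pair (t, w)).
Proof.
move=> mphi phi0.
have mc := @measurable_cons_pair R n.
transitivity (\int[pushforward (lam \x leb n) (@cons_pair R n)]_y phi y).
  by [].
rewrite ge0_integral_pushforward//= fubini_tonelli1//.
exact: measurableT_comp.
Qed.

Lemma integral_leb_translate n (x : Rn R n) (phi : Rn R n -> \bar R) :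
  measurable_fun setT phi -> (forall y, 0 <= phi y) ->
  \int[leb n]_y phi (vadd x y) = \int[leb n]_y phi y.
Proof.
elim: n x phi => [|n IH] x phi mphi phi0.
  by apply: eq_integral => y _; congr phi; apply: eq_from_tnth => -[].
have [a [v ->]] := cons_pair_eta x.
have mphiv y : measurable_fun setT (fun w : Rn R n => phi (cons_pair (y, w))).
  apply: measurableT_comp => //.
  exact: (measurableT_comp (@measurable_cons_pair R n)).
rewrite integral_leb_cons//; last first.
  by apply: measurableT_comp => //; exact: measurable_vadd.
under eq_integral => t _.
  under eq_integral => w _ do rewrite vadd_cons.
  rewrite (IH v (fun w => phi (cons_pair ((a + t)%R, w))))//.
  over.
rewrite (integral_leb_cons mphi phi0).
apply: (lebesgue_integral_translate a (phi := fun t => \int[leb n]_w phi (cons_pair (t, w)))).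
  apply: (measurable_fun_fubini_tonelli_F (m2 := leb n) (phi \o @cons_pair R n)) => //=.
  by apply: measurableT_comp => //; exact: measurable_cons_pair.
by move=> t; exact: integral_ge0.
Qed.

Lemma integral_leb_dilate n s (phi : Rn R n -> \bar R) : (0 < s)%R ->
  measurable_fun setT phi -> (forall y, 0 <= phi y) ->
  \int[leb n]_y phi (vscale s y) = (s ^- n)%:E * \int[leb n]_y phi y.
Proof.
move=> s0; elim: n phi => [|n IH] phi mphi phi0.
  rewrite expr0 invr1 mul1e.
  by apply: eq_integral => y _; congr phi; apply: eq_from_tnth => -[].
have mphiv y : measurable_fun setT (fun w : Rn R n => phi (cons_pair (y, w))).
  apply: measurableT_comp => //.
  exact: (measurableT_comp (@measurable_cons_pair R n)).
have mF : measurable_fun setT (fun t => \int[leb n]_w phi (cons_pair (t, w))).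
  apply: (measurable_fun_fubini_tonelli_F (m2 := leb n) (phi \o @cons_pair R n)) => //=.
  by apply: measurableT_comp => //; exact: measurable_cons_pair.
rewrite integral_leb_cons//; last first.
  by apply: measurableT_comp => //; exact: measurable_vscale.
under eq_integral => t _.
  under eq_integral => w _ do rewrite vscale_cons.
  rewrite (IH (fun w => phi (cons_pair ((s * t)%R, w))))//.
  over.
rewrite ge0_integralZl//; last 3 first.
  - by apply: (measurableT_comp mF); exact: measurable_funM.
  - by move=> t _; exact: integral_ge0.
  - by rewrite lee_fin invr_ge0 exprn_ge0// ltW.
rewrite (lebesgue_integral_dilate s0 mF); last by move=> t; exact: integral_ge0.
rewrite integral_leb_cons// muleA -EFinM; congr (_%:E * _).
by rewrite exprSr invfM mulrC.
Qed.

(** Besides fixing the radial constant, the Gaussian serves as a radial function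
    of finite nonzero integral in [integral_leb_isometry]. *)
Lemma integral_leb_gauss n :
  \int[leb n]_y (expR (- (enorm y : R) ^+ 2))%:E = (Num.sqrt pi ^+ n)%:E.
Proof.
have mg k : measurable_fun setT (fun y : Rn R k => (expR (- enorm y ^+ 2))%:E).
  apply/measurable_EFinP; apply: (measurableT_comp (@measurable_expR R)).
  by apply: measurable_funN; apply: measurable_funX; exact: measurable_enorm.
elim: n => [|n IH].
  rewrite expr0 /= integral_dirac//; last exact: (mg 0%N).
  by rewrite /enorm big_ord0 sqrtr0 expr0n oppr0 expR0 diracE mem_set// mul1e.
rewrite (integral_leb_cons (mg n.+1)); last by move=> y; rewrite lee_fin expR_ge0.
transitivity (\int[lam]_t ((gauss_fun t)%:E * (Num.sqrt pi ^+ n)%:E)).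
  apply: eq_integral => t _; rewrite -IH -ge0_integralZl//.
  - apply: eq_integral => w _; rewrite enorm_cons sqr_sqrtr.
      by rewrite opprD expRD EFinM.
    by rewrite addr_ge0// sqr_ge0.
  - exact: mg.
  - by rewrite lee_fin gauss_fun_ge0.
rewrite ge0_integralZr//=.
- by rewrite integralT_gauss -EFinM exprS.
- apply/measurable_EFinP; exact: measurable_gauss_fun.
- by move=> t _; rewrite lee_fin gauss_fun_ge0.
Qed.

End euclidean_space.

(** * Invariance under reflections *)
Section orthogonal_invariance.
Context {R : realType}.
Local Open Scope ereal_scope.

(** The argument is that of uniqueness of Haar measure. With [psi] the Gaussian,
    the product of the integrals of [psi] and [phi] is the double integral of
    [psi (Q x) * phi (y + Q x)], by a translation in [y]. Since
    [y + Q x = Q (x + Q y)], a translation in [x] turns this into the double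
    integral of [psi (Q x - y) * phi (Q x)], and a translation in [y] leaves the
    product of the integrals of [psi] and [phi \o Q]. The integral of [psi]
    cancels. *)
Lemma integral_leb_isometry n (Q : Rn R n -> Rn R n) (phi : Rn R n -> \bar R) :
  measurable_fun setT Q -> {morph Q : x y / vadd x y} ->
  {morph Q : x / vscale (-1) x} -> involutive Q ->
  (forall y, enorm (Q y) = enorm y) ->
  measurable_fun setT phi -> (forall y, 0 <= phi y) ->
  \int[leb n]_y phi (Q y) = \int[leb n]_y phi y.
Proof.
move=> mQ QD QN QK Qnorm mphi phi0.
pose psi (y : Rn R n) := (expR (- (enorm y : R) ^+ 2))%:E.
have mpsi : measurable_fun setT psi.
  apply/measurable_EFinP; apply: (measurableT_comp (@measurable_expR R)).
  by apply: measurable_funN; apply: measurable_funX; exact: measurable_enorm.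
have psi0 y : 0 <= psi y by rewrite lee_fin expR_ge0.
have mphiQ : measurable_fun setT (fun y => phi (Q y)) by exact: measurableT_comp.
have madd (f g : Rn R n * Rn R n -> Rn R n) : measurable_fun setT f ->
    measurable_fun setT g -> measurable_fun setT (fun p => vadd (f p) (g p)).
  by move=> mf mg; apply: measurable_mktuple => i; apply: measurable_funD;
    apply: (measurableT_comp (measurable_coord i)).
have mQ1 : measurable_fun setT (fun p : Rn R n * Rn R n => Q p.1).
  exact: (measurableT_comp mQ).
have addNK (a b : Rn R n) : vadd a (vadd (vscale (-1) a) b) = b.
  by apply: eq_from_tnth => i; rewrite !tnth_mktuple mulN1r addNKr.
have enormN (a : Rn R n) : enorm (vscale (-1) a) = enorm a.
  rewrite /enorm; congr Num.sqrt; apply: eq_bigr => i _.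
  by rewrite tnth_mktuple mulN1r sqrrN.
suff E : \int[leb n]_y psi y * \int[leb n]_y phi y =
         \int[leb n]_y psi y * \int[leb n]_y phi (Q y).
  have Ipos : (0 < Num.sqrt pi ^+ n :> R)%R.
    by rewrite exprn_gt0// sqrtr_gt0 pi_gt0.
  move: E; rewrite /psi integral_leb_gauss => E.
  have := congr1 (fun z => (Num.sqrt pi ^- n)%:E * z) E.
  by rewrite !muleA -!EFinM mulVf ?mul1e ?gt_eqF.
pose K (p : Rn R n * Rn R n) := psi (Q p.1) * phi (vadd p.2 (Q p.1)).
have mK : measurable_fun setT K.
  apply: emeasurable_funM; first exact: (measurableT_comp mpsi).
  by apply: (measurableT_comp mphi); apply: madd.
pose L (p : Rn R n * Rn R n) := psi (vadd (vscale (-1) p.1) (Q p.2)) * phi (Q p.2).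
have mQ2 : measurable_fun setT (fun p : Rn R n * Rn R n => Q p.2).
  exact: (measurableT_comp mQ).
have mL : measurable_fun setT L.
  apply: emeasurable_funM; last exact: (measurableT_comp mphi).
  apply: (measurableT_comp mpsi); apply: madd => //.
  exact: (measurableT_comp (measurable_vscale _)).
transitivity (\int[leb n]_x \int[leb n]_y K (x, y)).
  have <- : \int[leb n]_x psi (Q x) = \int[leb n]_x psi x.
    by apply: eq_integral => x _; rewrite /psi Qnorm.
  rewrite -ge0_integralZr//; last 2 first.
  - exact: measurableT_comp.
  - exact: integral_ge0.
  apply: eq_integral => x _; rewrite /K/= ge0_integralZl//; last first.
    rewrite (_ : (fun y => _) = (fun y => phi (vadd (Q x) y))).
      exact: (measurableT_comp mphi (measurable_vadd _)).
    apply/funext => y; congr phi.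
    by apply: eq_from_tnth => i; rewrite !tnth_mktuple addrC.
  congr (_ * _); rewrite -[LHS](integral_leb_translate (Q x))//.
  apply: eq_integral => y _; congr phi.
  by apply: eq_from_tnth => i; rewrite !tnth_mktuple addrC.
rewrite (fubini_tonelli K)//; last by move=> p; rewrite mule_ge0.
transitivity (\int[leb n]_y \int[leb n]_x L (y, x)).
  apply: eq_integral => y _.
  have mKy : measurable_fun setT (fun x => K (x, y)).
    exact: (measurableT_comp mK (measurable_pair2 y)).
  rewrite -(integral_leb_translate (vscale (-1) (Q y)) mKy); last first.
    by move=> x; rewrite mule_ge0.
  by apply: eq_integral => x _; rewrite /K /L/= QD QN QK addNK.
rewrite -(fubini_tonelli (fun p => L (p.2, p.1))); last 2 first.
- apply: (measurableT_comp mL (g := unstable.swap)).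
  exact: measurable_swap.
- by move=> p; rewrite mule_ge0.
rewrite -ge0_integralZl//; last exact: integral_ge0.
apply: eq_integral => x _; rewrite /L/=.
have mpsix : measurable_fun setT
    (fun y : Rn R n => psi (vadd (vscale (-1) y) (Q x))).
  apply: (measurableT_comp mpsi); apply: measurable_mktuple => i.
  apply: measurable_funD => //.
  exact: (measurableT_comp (measurable_coord i) (measurable_vscale _)).
transitivity ((\int[leb n]_y psi (vadd (vscale (-1) y) (Q x))) * phi (Q x)).
  exact: (ge0_integralZr (leb n) measurableT mpsix).
rewrite -(integral_leb_translate (vscale (-1) (Q x)) mpsi psi0).
apply: (congr1 (fun z => z * phi (Q x))); apply: eq_integral => y _.
rewrite /psi -[in RHS]enormN.
congr (expR (- enorm _ ^+ 2))%:E.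
by apply: eq_from_tnth => i; rewrite !tnth_mktuple; ring.
Qed.

Local Open Scope ring_scope.

(** Division by zero makes this the identity when [v = 0]. *)
Definition householder n (v y : Rn R n) : Rn R n :=
  vadd y (vscale (- (2 * vdot v y / vdot v v)) v).

Lemma measurable_vdot n (v : Rn R n) : measurable_fun setT (vdot v).
Proof.
by apply: measurable_sum => i; apply: measurable_funM => //; exact: measurable_coord.
Qed.

Lemma vdotC n (x y : Rn R n) : vdot x y = vdot y x.
Proof. by apply: eq_bigr => i _; rewrite mulrC. Qed.

Lemma vdotDr n (x y z : Rn R n) : vdot x (vadd y z) = vdot x y + vdot x z.
Proof. by rewrite -big_split; apply: eq_bigr => i _; rewrite tnth_mktuple mulrDr. Qed.

Lemma vdotZr n s (x y : Rn R n) : vdot x (vscale s y) = s * vdot x y.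
Proof. by rewrite mulr_sumr; apply: eq_bigr => i _; rewrite tnth_mktuple mulrCA. Qed.

Lemma vdotDl n (x y z : Rn R n) : vdot (vadd y z) x = vdot y x + vdot z x.
Proof. by rewrite vdotC vdotDr !(vdotC x). Qed.

Lemma vdotZl n s (x y : Rn R n) : vdot (vscale s y) x = s * vdot y x.
Proof. by rewrite vdotC vdotZr (vdotC x). Qed.

Lemma vdotvv_eq0 n (v : Rn R n) i : vdot v v = 0 -> tnth v i = 0.
Proof.
move=> vv0; apply/eqP; rewrite -sqrf_eq0; apply/eqP.
apply: (@psumr_eq0P _ _ xpredT (fun j => tnth v j ^+ 2)) => //.
by move=> j _; exact: sqr_ge0.
Qed.

Lemma vdot_eq0 n (v y : Rn R n) : vdot v v = 0 -> vdot v y = 0.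
Proof. by move=> vv0; rewrite /vdot big1// => i _; rewrite vdotvv_eq0 ?mul0r. Qed.

Lemma vdot_householder n (v y : Rn R n) : vdot v (householder v y) = - vdot v y.
Proof.
rewrite vdotDr vdotZr; have [vv0|vv0] := eqVneq (vdot v v) 0.
  by rewrite vv0 (vdot_eq0 y vv0); ring.
by rewrite mulNr divfK//; ring.
Qed.

Lemma enorm_householder n (v y : Rn R n) : enorm (householder v y) = enorm y.
Proof.
apply/eqP; rewrite -(eqrXn2 (ltn0Sn 1)) ?enorm_ge0// !enorm_sqr; apply/eqP.
rewrite {1}/householder vdotDl vdotZl vdot_householder (vdotC y) /householder.
rewrite vdotDl vdotZl; ring.
Qed.

Lemma householderK n (v : Rn R n) : involutive (householder v).
Proof.
move=> y; rewrite {1}/householder vdot_householder.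
by apply: eq_from_tnth => i; rewrite !tnth_mktuple; ring.
Qed.

Lemma householderD n (v : Rn R n) : {morph householder v : x y / vadd x y}.
Proof.
move=> x y; rewrite /householder vdotDr.
by apply: eq_from_tnth => i; rewrite !tnth_mktuple; ring.
Qed.

Lemma householderZ n (v : Rn R n) s : {morph householder v : x / vscale s x}.
Proof.
move=> x; rewrite /householder vdotZr.
by apply: eq_from_tnth => i; rewrite !tnth_mktuple; ring.
Qed.

Lemma measurable_householder n (v : Rn R n) : measurable_fun setT (householder v).
Proof.
apply: measurable_mktuple => i; apply: measurable_funD; first exact: measurable_coord.
under eq_fun do rewrite tnth_mktuple.
apply: measurable_funM => //; apply: measurable_funN.
by do 2 apply: measurable_funM => //; exact: measurable_vdot.
Qed.

Definition vaxis n (r : R) : Rn R n.+1 := cons_pair (r, [tuple 0 | i < n]).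

(** The reflection exchanging two vectors of equal norm has their difference as
    normal vector; for [v = x - e] this rests on [<v, v> = 2 <v, x>]. *)
Lemma exists_isometry_to_axis n (x : Rn R n.+1) : exists v,
  householder v x = vaxis n (enorm x).
Proof.
set r := enorm x; set e := vaxis n r.
pose v := vadd x (vscale (-1) e); exists v.
have ee : vdot e e = r ^+ 2.
  rewrite /vdot big_ord_recl tnth0 big1 ?addr0 ?expr2// => i _.
  by rewrite tnthS tnth_mktuple mulr0.
have xx : vdot x x = r ^+ 2 by rewrite -enorm_sqr.
have vv : vdot v v = 2 * vdot v x.
  rewrite /v !(vdotDr, vdotDl, vdotZr, vdotZl) ee xx (vdotC e); ring.
have [vv0|vv0] := eqVneq (vdot v v) 0.
  (* x lies on the axis already, and the reflection is the identity *)
  have v0 i : tnth v i = 0 by exact: vdotvv_eq0.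
  apply: eq_from_tnth => i.
  rewrite tnth_mktuple [tnth (vscale _ v) i]tnth_mktuple v0 mulr0 addr0.
  by apply/eqP; rewrite -subr_eq0; have := v0 i; rewrite !tnth_mktuple mulN1r => ->.
rewrite /householder -vv divff//.
by apply: eq_from_tnth => i; rewrite !tnth_mktuple; ring.
Qed.

Lemma tsub_vadd n (x y : Rn R n) : tsub x y = vadd x (vscale (-1) y).
Proof. by apply: eq_from_tnth => i; rewrite !tnth_mktuple; ring. Qed.

Lemma integral_leb_bipolar n (x : Rn R n.+1) (Psi : R -> R -> \bar R) :
  measurable_fun setT (fun p : R * R => Psi p.1 p.2) ->
  (forall a b, 0 <= Psi a b)%E ->
  (\int[leb n.+1]_y Psi (enorm y) (enorm (tsub x y)) =
   \int[leb n.+1]_y Psi (enorm y) (enorm (tsub (vaxis n (enorm x)) y)))%E.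
Proof.
move=> mPsi Psi0; have [v vx] := exists_isometry_to_axis x.
pose phi (y : Rn R n.+1) := Psi (enorm y) (enorm (tsub (vaxis n (enorm x)) y)).
rewrite -[RHS](@integral_leb_isometry _ (householder v) phi).
- apply: eq_integral => y _; rewrite /phi -vx !tsub_vadd -householderZ.
  by rewrite -householderD !enorm_householder.
- exact: measurable_householder.
- exact: householderD.
- exact: householderZ.
- exact: householderK.
- exact: enorm_householder.
- apply: (measurableT_comp mPsi
    (g := fun y : Rn R n.+1 => (enorm y, enorm (tsub (vaxis n (enorm x)) y)))).
  apply/measurable_fun_pairP; split => /=.
    exact: measurable_enorm.
  exact: (measurableT_comp (@measurable_enorm R _) (measurable_tsub _)).
- by move=> y; exact: Psi0.
Qed.

End orthogonal_invariance.

(** * Polar integration from homogeneity *)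
Section polar.
Context {R : realType}.
Local Notation lam := (@lebesgue_measure R).
Local Open Scope ereal_scope.

Lemma integral_itv_if (i : interval R) (f : R -> \bar R) :
  \int[lam]_(s in [set` i]) f s = \int[lam]_s (if s \in i then f s else 0).
Proof.
by rewrite integral_mkcond; apply: eq_integral => s _; rewrite patchE mem_setE.
Qed.

Lemma measurable_inv : measurable_fun [set: R] (fun x : R => x^-1)%R.
Proof.
rewrite (_ : (fun x => _) = (fun x : R => x * (x ^+ 2) `^ (-1))%R).
  apply: measurable_funM => //.
  by apply: (measurableT_comp (@measurable_powR R (-1))); exact: measurable_funX.
apply/funext => x; rewrite powR_inv1 ?sqr_ge0//.
have [->|x0] := eqVneq x 0%R; first by rewrite invr0 mul0r.
by rewrite expr2 invfM mulrA divff ?mul1r.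
Qed.

(** Homogeneity alone forces the image of [mu] under [N] to have density
    [c * s^(p-1)]. For [N y > 0], the value [h (N y)] is the integral over
    [s] in ]0, N y] of [h (N y) / N y]. After exchanging the integrals, apply the
    dilation of ratio [s] to [y]; after exchanging them back, rescale [s] by
    [N y]. What remains is the integral of [h s * s^(p-1)] times a factor in
    which [h] does not occur. *)
Lemma polar_integration d (T : measurableType d)
    (mu : {sigma_finite_measure set T -> \bar R}) (N : T -> R)
    (D : R -> T -> T) (p : R) :
  measurable_fun setT N ->
  (forall s, measurable_fun setT (D s)) ->
  (forall s y, (0 < s)%R -> N (D s y) = s * N y)%R ->
  (forall s (phi : T -> \bar R), (0 < s)%R -> measurable_fun setT phi ->
    (forall y, 0 <= phi y) ->
    \int[mu]_y phi (D s y) = (s `^ (- p))%:E * \int[mu]_y phi y) ->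
  exists2 c : \bar R, 0 <= c & forall h : R -> \bar R,
    measurable_fun setT h -> (forall s, 0 <= h s) ->
    \int[mu]_y (if (0 < N y)%R then h (N y) else 0) =
    c * \int[lam]_s (if (0 < s)%R then (s `^ (p - 1))%:E * h s else 0).
Proof.
move=> mN mD ND muD.
pose w y := if (1 <= N y)%R then ((N y)^-1 * (N y) `^ (- (p - 1)) * (N y)^-1)%R else 0%R.
have w0 y : (0 <= w y)%R.
  rewrite /w; case: ifPn => // N1.
  by rewrite !mulr_ge0 ?powR_ge0// invr_ge0 (le_trans ler01).
have mNV : measurable_fun setT (fun y => (N y)^-1)%R.
  exact: (measurableT_comp measurable_inv).
have mw : measurable_fun setT w.
  apply: measurable_fun_ifT => //; first exact: measurable_fun_ler.
  apply: measurable_funM => //; apply: measurable_funM => //.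
  exact: (measurableT_comp (@measurable_powR R _)).
exists (\int[mu]_y (w y)%:E) => [|h mh h0].
  by apply: integral_ge0 => y _; rewrite lee_fin.
(* L is K after the dilation of ratio q.2, with the factor q.2^p it brings *)
pose K (q : T * R) := if (0 < q.2)%R && (q.2 <= N q.1)%R
  then ((N q.1)^-1)%:E * h (N q.1) else 0.
pose L (q : T * R) := if (0 < q.2)%R && (1 <= N q.1)%R
  then ((N q.1)^-1 * q.2 `^ (p - 1))%:E * h (q.2 * N q.1)%R else 0.
have mN1 : measurable_fun setT (fun q : T * R => N q.1).
  exact: (measurableT_comp mN).
have mNV1 : measurable_fun setT (fun q : T * R => (N q.1)^-1)%R.
  exact: (measurableT_comp mNV).
have mK : measurable_fun setT K.
  apply: measurable_fun_ifT => //.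
    by apply: measurable_and; [exact: measurable_fun_ltr | exact: measurable_fun_ler].
  apply: emeasurable_funM; first exact/measurable_EFinP.
  exact: (measurableT_comp mh).
have mL : measurable_fun setT L.
  apply: measurable_fun_ifT => //.
    by apply: measurable_and; [exact: measurable_fun_ltr | exact: measurable_fun_ler].
  apply: emeasurable_funM.
    apply/measurable_EFinP; apply: measurable_funM => //.
    exact: (measurableT_comp (@measurable_powR R _)).
  by apply: (measurableT_comp mh); exact: measurable_funM.
have K0 q : 0 <= K q.
  rewrite /K; case: ifPn => // /andP[q0 qN]; rewrite mule_ge0// lee_fin invr_ge0.
  by rewrite ltW// (lt_le_trans q0).
have L0 q : 0 <= L q.
  rewrite /L; case: ifPn => // /andP[q0 qN]; rewrite mule_ge0// lee_fin.
  by rewrite mulr_ge0 ?powR_ge0// invr_ge0 (le_trans ler01).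
transitivity (\int[mu]_y \int[lam]_s K (y, s)).
  apply: eq_integral => y _; case: ifPn => [Ny|]; last first.
    rewrite -leNgt => Ny; rewrite integral0_eq// => s _; rewrite /K/=.
    by case: ifPn => // /andP[s0 /(lt_le_trans s0)]; rewrite ltNge Ny.
  transitivity (\int[lam]_(s in `]0%R, N y]) (((N y)^-1)%:E * h (N y))).
    rewrite integral_cst//= lebesgue_measure_itv/= lte_fin Ny oppr0 adde0.
    by rewrite muleAC -EFinM mulVf ?mul1e ?gt_eqF.
  by rewrite integral_itv_if; apply: eq_integral => s _; rewrite in_itv.
rewrite fubini_tonelli//.
transitivity (\int[lam]_s \int[mu]_y L (y, s)).
  apply: eq_integral => s _; have [s0|s0] := ltP 0%R s; last first.
    by rewrite !integral0_eq// => y _; rewrite /K /L/= ltNge s0.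
  have mKs : measurable_fun setT (fun y => K (y, s)).
    exact: (measurableT_comp mK (measurable_pair2 s)).
  have := muD s _ s0 mKs (fun y => K0 (y, s)).
  move=> /(congr1 (fun z => (s `^ p)%:E * z)).
  rewrite muleA -EFinM -powRD ?subrr ?powRr0 ?mul1e; last first.
    by apply/implyP => _; rewrite gt_eqF.
  move=> <-; rewrite -ge0_integralZl//; last 2 first.
  - exact: (measurableT_comp mKs (mD s)).
  - by rewrite lee_fin powR_ge0.
  apply: eq_integral => y _; rewrite /K /L/= s0/= ND// -{1}[X in (X <= _)%R](mulr1 s).
  rewrite ler_pM2l//; case: ifPn => [N1|_]; last by rewrite mule0.
  rewrite muleA -EFinM; congr (_%:E * _).
  rewrite powRD ?powR_inv1 ?ltW// ?invfM; first by ring.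
  by apply/implyP => _; rewrite gt_eqF.
rewrite -fubini_tonelli//.
pose H s := if (0 < s)%R then (s `^ (p - 1))%:E * h s else 0.
have H0 s : 0 <= H s by rewrite /H; case: ifPn => // _; rewrite mule_ge0// lee_fin powR_ge0.
have mH : measurable_fun setT H.
  apply: measurable_fun_ifT => //; first exact: measurable_fun_ltr.
  apply: emeasurable_funM => //; apply/measurable_EFinP.
  exact: measurable_powR.
rewrite -/(H _) -ge0_integralZr//; last 3 first.
- exact/measurable_EFinP.
- by move=> y _; rewrite lee_fin.
- by apply: integral_ge0 => s _; exact: H0.
apply: eq_integral => y _; rewrite /w.
case: ifPn => N1; last first.
  by rewrite mul0e integral0_eq// => s _; rewrite /L/= (negbTE N1) andbF.
have N0 : (0 < N y)%R by exact: lt_le_trans N1.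
rewrite EFinM -muleA -(lebesgue_integral_dilate N0 mH)// -ge0_integralZl//; last 2 first.
- by apply: (measurableT_comp mH); exact: measurable_funM.
- by rewrite lee_fin mulr_ge0 ?powR_ge0// invr_ge0 ltW.
apply: eq_integral => s _; rewrite /L /H/= N1 andbT pmulr_rgt0//.
case: ifPn => s0; last by rewrite mule0.
rewrite muleA -EFinM (mulrC s); congr (_%:E * _).
rewrite powRM ?ltW// -mulrA; congr (_ * _)%R.
rewrite mulrA -powRD ?addNr ?powRr0 ?mul1r//.
by apply/implyP => _; rewrite gt_eqF.
Qed.

End polar.

(** * The radial constant *)
Section radial.
Context {R : realType}.
Local Notation lam := (@lebesgue_measure R).
Local Open Scope ereal_scope.

(** Polar integration sees only the points other than the origin, which is a box
    of volume zero. *)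
Lemma integral_leb_enorm_gt0 n (h : R -> \bar R) :
  measurable_fun setT h -> (forall s, 0 <= h s) ->
  \int[leb n.+1]_y (if (0 < enorm y)%R then h (enorm y) else 0) =
  \int[leb n.+1]_y h (enorm y).
Proof.
move=> mh h0; have mE := @measurable_enorm R n.+1.
apply: ge0_ae_eq_integral => //.
- apply: measurable_fun_ifT => //; first exact: measurable_fun_ltr.
  exact: measurableT_comp.
- exact: measurableT_comp.
- by move=> y _; case: ifPn.
exists [set y | enorm y = 0%R]; split.
- by have := mE measurableT _ (measurable_set1 0%R); rewrite setTI.
- pose z := fun _ : 'I_n.+1 => 0%R : R.
  transitivity (leb n.+1 [set y : Rn R n.+1 | forall i, (z i <= tnth y i <= z i)%R]); last first.
    by rewrite leb_box// big_ord_recl subrr mul0r.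
  congr (leb n.+1 _); apply/seteqP; split => y /= Hy.
    move=> i; rewrite /z -eq_le eq_sym; apply/eqP; apply: vdotvv_eq0.
    by rewrite -enorm_sqr Hy expr0n.
  rewrite /enorm big1 ?sqrtr0// => i _; have /= := Hy i.
  by rewrite /z -eq_le => /eqP <-; rewrite expr0n.
- move=> y /=; apply: contra_notP => /eqP yn _.
  by rewrite lt_neqAle eq_sym yn enorm_ge0.
Qed.

(** The substitution [t = s^2], on an interval that avoids the singularity of the
    power at [0]. *)
Lemma integral_sqr_substitution n :
  \int[lam]_(t in `[1%R, 4%R]) (t `^ (n.+1%:R / 2 - 1))%:E =
  2%:E * \int[lam]_(s in `[1%R, 2%R]) (s ^+ n)%:E.
Proof.
have -> : `[1%R : R, 4%R]%classic = `[(1 ^+ 2)%R, (2 ^+ 2)%R]%classic.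
  by rewrite expr1n -natrX.
have dF : derive1 (fun x : R => (x ^+ 2)%R) = (fun x : R => 2 * x)%R.
  apply/funext => x; rewrite derive1E; rewrite exp_derive/= expr1 /GRing.scale/= mulr1.
  by rewrite mulr_natl.
rewrite (@integration_by_substitution_increasing R (fun x => x ^+ 2)%R
   (fun t => t `^ (n.+1%:R / 2 - 1))%R 1 2); last first.
- apply: continuous_in_subspaceT => x; rewrite inE/= in_itv/= expr1n => /andP[x1 _].
  have x0 : (0 < x)%R by exact: lt_le_trans x1.
  apply: differentiable_continuous; apply/derivable1_diffP.
  by apply: derivable_powR; rewrite in_itv/= x0.
- split.
  + by move=> x _; exact: exprn_derivable.
  + by apply: cvg_at_right_filter; apply: exprn_continuous.
  + by apply: cvg_at_left_filter; apply: exprn_continuous.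
- rewrite dF. apply: (cvgP ((2 * 2)%R : R)); apply: cvg_at_left_filter.
  exact: mulrl_continuous.
- rewrite dF; apply: (cvgP ((2 * 1)%R : R)); apply: cvg_at_right_filter.
  exact: mulrl_continuous.
- by rewrite dF => x _; exact: mulrl_continuous.
- move=> x y; rewrite !in_itv/= => /andP[x1 _] /andP[y1 _] xy.
  by rewrite ltrXn2r// (le_trans ler01).
- by rewrite ler1n.
rewrite dF -ge0_integralZl//=; last 2 first.
- apply/measurable_EFinP; exact: measurable_funTS.
- move=> s; rewrite /= in_itv/= => /andP[s1 _].
  by rewrite lee_fin exprn_ge0// (le_trans ler01).
apply: eq_integral => s; rewrite inE/= in_itv/= => /andP[s1 _].
have s0 : (0 < s)%R by exact: lt_le_trans s1.
rewrite -EFinM; congr EFin.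
transitivity ((s ^+ 2) `^ (n.+1%:R / 2 - 1) * (2 * s))%R; first by [].
rewrite -(powR_mulrn 2 (ltW s0)) -powRrM.
rewrite mulrCA; congr (_ * _)%R.
rewrite -[X in (_ * X)%R](powRr1 (ltW s0)) -powRD; last first.
  by apply/implyP => _; rewrite gt_eqF.
rewrite -[RHS]powR_mulrn ?ltW//; congr (_ `^ _)%R.
by rewrite -[n.+1%:R]natr1; field.
Qed.

(** Polar integration is applied to [|y|], giving [c], and to [|y|^2], giving
    [c']. The Gaussian is [e^(-t)] in [t = |y|^2], so its integral is
    [c' * Gamma((n+1)/2)], directly in the form of Euler's integral. Testing both
    formulas on the shell [1 <= |y| <= 2] gives [c = 2 c']. *)
Lemma exists_radial_constant n : exists c : \bar R,
  [/\ 0 <= c,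
    c * (Gamma (n.+1%:R / 2))%:E = (2 * Num.sqrt pi ^+ n.+1)%:E &
    forall h : R -> \bar R, measurable_fun setT h -> (forall s, 0 <= h s) ->
    \int[leb n.+1]_y h (enorm y) =
    c * \int[lam]_s (if (0 < s)%R then (s ^+ n)%:E * h s else 0)].
Proof.
have [c c0 Hc] := @polar_integration R _ _ (leb n.+1) (@enorm R n.+1)
  (fun s => @vscale R n.+1 s) n.+1%:R (@measurable_enorm R n.+1)
  (fun s => @measurable_vscale R n.+1 s)
  (fun s y s0 => enorm_scale y (ltW s0))
  (fun s phi s0 mphi phi0 => etrans (integral_leb_dilate s0 mphi phi0)
     (congr1 (fun z => z%:E * _) (esym (powR_invn _ (ltW s0))))).
have mN2 : measurable_fun setT (fun y : Rn R n.+1 => enorm y ^+ 2)%R.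
  by apply: measurable_funX; exact: measurable_enorm.
have N2D (s : R) (y : Rn R n.+1) : (0 < s ->
    enorm (vscale (Num.sqrt s) y) ^+ 2 = s * enorm y ^+ 2)%R.
  by move=> s0; rewrite enorm_scale ?sqrtr_ge0// exprMn sqr_sqrtr// ltW.
have N2mu (s : R) (phi : Rn R n.+1 -> \bar R) : (0 < s)%R ->
    measurable_fun setT phi -> (forall y, 0 <= phi y) ->
    \int[leb n.+1]_y phi (vscale (Num.sqrt s) y) =
    (s `^ (- (n.+1%:R / 2)))%:E * \int[leb n.+1]_y phi y.
  move=> s0 mphi phi0; rewrite integral_leb_dilate ?sqrtr_gt0//.
  congr (_%:E * _); rewrite -powR_invn ?sqrtr_ge0// -powR12_sqrt ?ltW// -powRrM.
  by congr (_ `^ _)%R; ring.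
have [c' c'0 Hc'] := @polar_integration R _ _ (leb n.+1)
  (fun y => enorm y ^+ 2)%R (fun s => @vscale R n.+1 (Num.sqrt s))
  (n.+1%:R / 2)%R mN2
  (fun s => @measurable_vscale R n.+1 _) N2D N2mu.
have powE (s : R) : (0 < s -> s `^ (n.+1%:R - 1) = s ^+ n)%R.
  by move=> s0; rewrite -natr1 addrK powR_mulrn// ltW.
have sqr_gt0E (y : Rn R n.+1) : (0 < enorm y ^+ 2)%R = (0 < enorm y)%R.
  by rewrite exprn_even_gt0//= lt_neqAle enorm_ge0 eq_sym andbT.
have c2c' : c = 2%:E * c'.
  pose h (s : R) : \bar R := if (1 <= s <= 2)%R then 1 else 0.
  have mh : measurable_fun setT h.
    by apply: measurable_fun_ifT => //; apply: measurable_and;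
      exact: measurable_fun_ler.
  have h0 s : 0 <= h s by rewrite /h; case: ifPn.
  have mhs : measurable_fun setT (fun t : R => h (Num.sqrt t)).
    exact: (measurableT_comp mh measurable_sqrt).
  pose I := \int[lam]_(s in `[1%R, 2%R]) (s ^+ n)%:E.
  have Igt0 : 0 < I.
    have : \int[lam]_(s in `[1%R, 2%R]) 1 <= I.
      apply: ge0_le_integral_nonmeas => // s /=; rewrite in_itv/= => /andP[s1 _].
      by rewrite lee_fin exprn_ege1.
    rewrite integral_cst//= lebesgue_measure_itv/= lte_fin ltrDl ltr01 mul1e.
    by apply: lt_le_trans; rewrite -EFinD lte_fin; lra.
  have Ifin : I \is a fin_num.
    rewrite ge0_fin_numE ?ltW//.
    have : I <= \int[lam]_(s in `[1%R, 2%R]) (2 ^+ n)%:E.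
      apply: ge0_le_integral_nonmeas => // s /=; rewrite in_itv/= => /andP[s1 s2].
        by rewrite lee_fin exprn_ge0// (le_trans ler01).
      by rewrite lee_fin lerXn2r// nnegrE (le_trans ler01)// (le_trans s1).
    move=> /le_lt_trans; apply.
    rewrite integral_cst//= lebesgue_measure_itv/= lte_fin ltrDl ltr01.
    by rewrite -EFinD -EFinM ltry.
  have := Hc h mh h0; rewrite integral_leb_enorm_gt0// => e1.
  have := Hc' _ mhs (fun s => h0 _).
  under eq_integral => y _ do rewrite sqr_gt0E sqrtr_sqr ger0_norm ?enorm_ge0//.
  rewrite integral_leb_enorm_gt0// {}e1.
  rewrite (_ : \int[lam]_s _ = I); last first.
    rewrite /I integral_itv_if; apply: eq_integral => s _.
    rewrite in_itv/= /h; case: ifPn => s0; last first.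
      case: ifPn => // /andP[s1 _]; case/negP: s0; exact: lt_le_trans s1.
    by case: ifPn => _; rewrite ?mule0 ?mule1// powE.
  rewrite (_ : \int[lam]_s _ = 2%:E * I); last first.
    rewrite -integral_sqr_substitution integral_itv_if; apply: eq_integral => s _.
    rewrite in_itv/= /h; case: ifPn => s0; last first.
      case: ifPn => // /andP[s1 _]; case/negP: s0; exact: lt_le_trans s1.
    have -> : (1 <= Num.sqrt s)%R = (1 <= s)%R.
      by rewrite -[X in (X <= Num.sqrt s)%R]sqrtr1 ler_sqrt// ltW.
    have -> : (Num.sqrt s <= 2)%R = (s <= 4)%R.
      have <- : (Num.sqrt 4 = 2 :> R)%R.
        by rewrite (_ : (4 = 2 ^+ 2 :> R)%R) ?sqrtr_sqr ?ger0_norm// -natrX.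
      by rewrite ler_sqrt.
    by case: ifPn => _; rewrite ?mule0 ?mule1.
  rewrite muleA (muleC c') => E.
  have := congr1 (fun z => z * (fine I)^-1%:E) E.
  rewrite -(fineK Ifin) -!muleA -!EFinM divff ?mule1//.
  by rewrite gt_eqF// fine_gt0// Igt0 ltey_eq Ifin.
have Gammac : c' * (Gamma (n.+1%:R / 2))%:E = (Num.sqrt pi ^+ n.+1)%:E.
  pose h (t : R) := (expR (- t))%:E.
  have mh : measurable_fun setT h.
    by apply/measurable_EFinP; apply: (measurableT_comp (@measurable_expR R)).
  have h0 t : 0 <= h t by rewrite lee_fin expR_ge0.
  have := Hc' h mh h0.
  under eq_integral => y _ do rewrite sqr_gt0E.
  rewrite (integral_leb_enorm_gt0 n (h := fun s => h (s ^+ 2)%R))//; last first.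
    by apply: (measurableT_comp mh); exact: measurable_funX.
  rewrite integral_leb_gauss.
  rewrite (_ : \int[lam]_s _ = \int[lam]_(t in `]0%R, +oo[)
      (t `^ (n.+1%:R / 2 - 1) * expR (- t))%:E); last first.
    rewrite integral_itv_if; apply: eq_integral => s _.
    by rewrite in_itv/= andbT; case: ifPn => // _; rewrite EFinM.
  set Ge := \int[lam]_(t in _) _ => E.
  have Ge0 : 0 <= Ge.
    by apply: integral_ge0 => t _; rewrite lee_fin mulr_ge0 ?powR_ge0 ?expR_ge0.
  have Ipos : (0 < Num.sqrt pi ^+ n.+1 :> R)%R.
    by rewrite exprn_gt0// sqrtr_gt0 pi_gt0.
  (* Gamma is a real-valued integral: it would be 0 if this one diverged *)
  suff Gfin : Ge \is a fin_num by rewrite /Gamma /Rintegral fineK// -E.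
  rewrite ge0_fin_numE// ltey; apply/eqP => Gy; move: E; rewrite Gy.
  move: c'0; rewrite le_eqVlt => /predU1P[<-|c'0].
    by rewrite mul0e => -[] /eqP; rewrite gt_eqF.
  by rewrite gt0_muley.
exists c; split => //.
  by rewrite c2c' -muleA Gammac -EFinM.
move=> h mh h0; rewrite -integral_leb_enorm_gt0// Hc//; congr (_ * _).
by apply: eq_integral => s _; case: ifPn => // s0; rewrite powE.
Qed.

End radial.

(** * Change of variable along an expanding map *)
Section expanding_substitution.
Context {R : realType}.
Local Notation lam := (@lebesgue_measure R).

(** Named so that it can carry a cumulative structure, and with it a Stieltjes
    measure. *)
Definition id_plus (e : R -> R) : R -> R := fun x => x + e x.

Section id_plus_cumulative.
Variable e : cumulative R R.

Let id_plus_nd : nondecreasing (id_plus e).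
Proof.
by move=> x y xy; apply: lerD => //; exact: cumulative_is_nondecreasing.
Qed.

Let id_plus_rc : right_continuous (id_plus e).
Proof.
move=> x; apply: cvgD; last exact: cumulative_is_right_continuous.
exact: (cumulative_is_right_continuous (idfun : cumulative R R)).
Qed.

HB.instance Definition _ := isCumulative.Build R _ R (id_plus e)
  id_plus_nd id_plus_rc.

End id_plus_cumulative.

Lemma lebesgue_stieltjes_measure_itvoc (f : cumulative R R) (a b : R) :
  lebesgue_stieltjes_measure f `]a, b]%classic =
  (if a < b then (f b - f a)%:E else 0%E).
Proof.
rewrite /lebesgue_stieltjes_measure/= /measure_extension/= measurable_mu_extE/=.
  by rewrite wlength_itv/= lte_fin; case: ifPn => //; rewrite EFinB.
exact: is_ocitv.
Qed.

Local Open Scope ereal_scope.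

(** The hypothesis on [T] says that [T] is inverse to [a |-> a + e a]. The image
    of Lebesgue measure under [T] is then the sum of Lebesgue measure and of the
    Stieltjes measure of [e]: both give [b - a + e b - e a] to ]a, b]. *)
Lemma le_integral_comp_expanding (e : cumulative R R) (T : R -> R) (phi : R -> \bar R) :
  measurable_fun setT T -> (forall a t, (a < T t) = (a + e a < t))%R ->
  measurable_fun setT phi -> (forall t, 0 <= phi t) ->
  \int[lam]_t phi t <= \int[lam]_t phi (T t).
Proof.
move=> mT aT mphi phi0.
have mT' : measurable_fun [set: measurableTypeR R] (T : _ -> measurableTypeR R) by [].
pose S := lebesgue_stieltjes_measure e.
have -> : \int[lam]_t phi (T t) = \int[measure_add lam S]_t phi t.
  transitivity (\int[pushforward lam (T : measurableTypeR R -> measurableTypeR R)]_t phi t).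
    by rewrite ge0_integral_pushforward.
  apply: eq_measure_integral => A mA _.
  transitivity (lebesgue_stieltjes_measure (id_plus e) A).
    apply/esym; apply: lebesgue_stieltjes_measure_unique => // _ [[a b] _ <-].
    rewrite lebesgue_stieltjes_measure_itvoc /pushforward.
    rewrite [X in _ = lam X](_ : _ = `](id_plus e a), (id_plus e b)]%classic); last first.
      by apply/seteqP; split => t /=; rewrite !in_itv/= aT !leNgt aT.
    rewrite lebesgue_measure_itv/= lte_fin; case: ifPn => ab.
      case: ifPn => // ; rewrite -leNgt => ba.
      have -> : id_plus e b = id_plus e a; last by rewrite subrr.
      apply/le_anti; rewrite ba; apply: (@cumulative_is_nondecreasing _ _ _ (id_plus e)).
      exact: ltW.
    rewrite ifN// -leNgt; apply: (@cumulative_is_nondecreasing _ _ _ (id_plus e)).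
    by rewrite leNgt.
  apply: lebesgue_stieltjes_measure_unique => // _ [[a b] _ <-].
  transitivity (lam `]a, b]%classic + S `]a, b]%classic); last first.
    exact/esym/measure_addE.
  rewrite /S !lebesgue_stieltjes_measure_itvoc lebesgue_measure_itv/= lte_fin.
  case: ifPn => _; last by rewrite adde0.
  by rewrite -!EFinD; congr EFin; rewrite /id_plus; ring.
rewrite ge0_integral_measure_add// leeDl//.
exact: integral_ge0.
Qed.

End expanding_substitution.

Section hypotenuse.
Context {R : realType}.
Local Notation lam := (@lebesgue_measure R).
Variables (s : R) (s0 : 0 < s).

Let M (x : R) := Num.max x s.

(** In a right triangle with hypotenuse [x > s] and one leg [s], the other leg
    minus [x]. For [x <= s] it is the constant [- s], so that
    [x |-> x + leg_excess x] is a bijection of the line. *)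
Definition leg_excess (x : R) : R := Num.sqrt (M x ^+ 2 - s ^+ 2) - M x.

(** Increments of the leg dominate those of the hypotenuse: if [u], [v] are the
    legs for hypotenuses [a <= b], then [(v - u) (v + u) = (b - a) (b + a)], and
    [v + u <= b + a]. *)
Let leg_excess_nd : nondecreasing leg_excess.
Proof.
move=> x y xy.
have Mxy : M x <= M y by rewrite /M ge_max !le_max xy lexx orbT.
have Mx : s <= M x by rewrite /M le_max lexx orbT.
rewrite /leg_excess; move: (M x) (M y) Mxy Mx => a b ab sa.
have a0 : 0 < a by exact: lt_le_trans sa.
have b0 : 0 < b by exact: lt_le_trans ab.
have a2 : 0 <= a ^+ 2 - s ^+ 2 by rewrite subr_ge0 lerXn2r ?nnegrE ?(ltW s0) ?(ltW a0).
have b2 : 0 <= b ^+ 2 - s ^+ 2.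
  by rewrite subr_ge0 lerXn2r ?nnegrE ?(ltW s0) ?(ltW b0)// (le_trans sa).
have uE := sqr_sqrtr a2; have vE := sqr_sqrtr b2.
have u0 := sqrtr_ge0 (a ^+ 2 - s ^+ 2); have v0 := sqrtr_ge0 (b ^+ 2 - s ^+ 2).
move: (Num.sqrt (a ^+ 2 - s ^+ 2)) (Num.sqrt (b ^+ 2 - s ^+ 2)) u0 v0 uE vE.
move=> u v u0 v0 uE vE.
have ua : u <= a.
  rewrite -(@ler_pXn2r _ 2) ?nnegrE ?(ltW a0)// uE lerBlDr lerDl; exact: sqr_ge0.
have vb : v <= b.
  rewrite -(@ler_pXn2r _ 2) ?nnegrE ?(ltW b0)// vE lerBlDr lerDl; exact: sqr_ge0.
have sum0 : 0 < a + b by exact: addr_gt0.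
have uv : u <= v.
  by rewrite -(@ler_pXn2r _ 2) ?nnegrE// uE vE lerB// lerXn2r// nnegrE ltW.
suff : b - a <= v - u by lra.
have [uv0|uv0] := ltP 0 (u + v); last first.
  have u00 : u = 0 by apply/le_anti; rewrite u0 andbT; lra.
  have v00 : v = 0 by apply/le_anti; rewrite v0 andbT; lra.
  have : a ^+ 2 = b ^+ 2 by move: uE vE; rewrite u00 v00 expr0n/=; lra.
  by move=> /eqP; rewrite eqrXn2 ?(ltW a0) ?(ltW b0)// => /eqP ->; rewrite u00 v00 !subrr.
rewrite -(ler_pM2r sum0).
have -> : (b - a) * (a + b) = (v - u) * (u + v).
  transitivity (v ^+ 2 - u ^+ 2); first by rewrite vE uE; ring.
  by ring.
rewrite ler_wpM2l ?subr_ge0//; lra.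
Qed.

Let leg_excess_rc : right_continuous leg_excess.
Proof.
apply/right_continuousW => x.
have cM : {for x, continuous M}.
  by apply: continuous_max => //; exact: cvg_cst.
have cM2 : {for x, continuous (fun y => M y ^+ 2)}.
  by apply: (@continuous_comp _ _ _ M (fun z => z ^+ 2)) => //; exact: exprn_continuous.
have cD : {for x, continuous (fun y => M y ^+ 2 - s ^+ 2)}.
  by apply: cvgB => //; exact: cvg_cst.
apply: cvgB => //.
apply: (@continuous_comp _ _ _ (fun y => M y ^+ 2 - s ^+ 2) Num.sqrt) => //.
exact: sqrt_continuous.
Qed.

HB.instance Definition _ := isCumulative.Build R _ R leg_excess
  leg_excess_nd leg_excess_rc.

Local Open Scope ereal_scope.

(** The map [t |-> sqrt (t^2 + s^2)] sends ]0, +oo[ onto ]s, +oo[ and contracts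
    lengths. *)
Lemma le_integral_hypotenuse (phi : R -> \bar R) :
  measurable_fun setT phi -> (forall x, 0 <= phi x) ->
  \int[lam]_x (if (s < x)%R then phi x else 0) <=
  \int[lam]_t (if (0 < t)%R then phi (Num.sqrt (t ^+ 2 + s ^+ 2)) else 0).
Proof.
move=> mphi phi0.
(* extended to a bijection of the line by a translation on the left of 0 *)
pose T (t : R) := if (0 < t)%R then Num.sqrt (t ^+ 2 + s ^+ 2)%R else (s + t)%R.
pose psi x := if (s < x)%R then phi x else 0.
have Ts t : (s < T t)%R = (0 < t)%R.
  rewrite /T; case: ifPn => t0; last by rewrite -ltrBlDl subrr (negbTE t0).
  rewrite -{1}(ger0_norm (ltW s0)) -sqrtr_sqr ltr_sqrt.
    by rewrite ltrDr exprn_gt0.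
  by rewrite addr_gt0// exprn_gt0.
have -> : \int[lam]_t (if (0 < t)%R then phi (Num.sqrt (t ^+ 2 + s ^+ 2)) else 0) =
    \int[lam]_t psi (T t).
  by apply: eq_integral => t _; rewrite /psi Ts /T; case: ifP.
apply: (@le_integral_comp_expanding _ leg_excess) => //.
- apply: measurable_fun_ifT => //; first exact: measurable_fun_ltr.
    apply: (measurableT_comp measurable_sqrt).
    by apply: measurable_funD => //; exact: measurable_funX.
  exact: measurable_funD.
- move=> a t; rewrite /= /leg_excess /M /T.
  have [as_|sa] := leP a s.
    rewrite subrr sqrtr0 sub0r ltrBlDl; case: ifPn => t0 //.
    have sT : (s < Num.sqrt (t ^+ 2 + s ^+ 2))%R by have := Ts t; rewrite /T t0.
    by rewrite (le_lt_trans as_ sT) (le_lt_trans as_)// ltrDl.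
  have a0 : (0 < a)%R by exact: lt_trans sa.
  rewrite (addrC a) subrK; case: ifPn => t0.
    rewrite -{1}(ger0_norm (ltW a0)) -sqrtr_sqr ltr_sqrt; last first.
      by rewrite addr_gt0// exprn_gt0.
    rewrite -{2}(ger0_norm (ltW t0)) -sqrtr_sqr ltr_sqrt ?exprn_gt0//.
    by rewrite ltrBlDr.
  rewrite -leNgt in t0.
  have -> : (a < s + t)%R = false.
    by apply/negbTE; rewrite -leNgt (le_trans _ (ltW sa))// gerDl.
  by apply/esym/negbTE; rewrite -leNgt (le_trans t0)// sqrtr_ge0.
- apply: measurable_fun_ifT => //; exact: measurable_fun_ltr.
- by move=> x; rewrite /psi; case: ifPn.
Qed.

End hypotenuse.

(** * Measurability of the functions G_n *)
Section profile_measurability.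
Context {R : realType}.
Local Notation lam := (@lebesgue_measure R).
Local Open Scope ereal_scope.

Lemma nonincreasing_emeasurable (g : R -> \bar R) :
  (forall r s, (r <= s)%R -> g s <= g r) -> measurable_fun setT g.
Proof.
move=> g_ni; apply: (measurability _ (ErealGenCInfty.measurableE R)).
move=> /= _ [_ [r ->] <-]; rewrite setTI.
apply: is_interval_measurable => s t/=.
rewrite !in_itv/= !andbT => _ ft u /andP[_ ut].
by rewrite in_itv/= andbT (le_trans ft)// g_ni.
Qed.

Lemma measurable_inve : measurable_fun [set: \bar R] (fun x => x^-1).
Proof.
rewrite (_ : (fun x => _) = (fun x : \bar R => if x == 0 then +oo else
    if x == -oo then -oo else ((fine x)^-1)%:E)); last first.
  apply/funext => -[r| |]//=; by rewrite invey invr0.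
have meq (c : \bar R) : measurable_fun setT (fun x : \bar R => x == c).
  apply: (measurable_fun_bool true); rewrite setTI.
  rewrite (_ : _ @^-1` _ = [set c]); first exact: emeasurable_set1.
  by apply/seteqP; split => x /= => [/eqP|->//]; rewrite ?eqxx.
apply: measurable_fun_ifT => //; apply: measurable_fun_ifT => //.
apply/measurable_EFinP; apply: (measurableT_comp measurable_inv).
exact: fine_measurable.
Qed.

Lemma inner_int_ge0 d (m u : R) : 0 <= inner_int d m u.
Proof.
apply: integral_ge0 => s /=; rewrite in_itv/= => /andP[s0 _].
by rewrite lee_fin mulr_ge0 ?expR_ge0// exprn_ge0.
Qed.

(** As a function of the upper limit, the integral is a section of a double
    integral. *)
Lemma measurable_inner_int d (m : R) : measurable_fun setT (inner_int d m).
Proof.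
pose K (q : R * R) := if (0 <= q.2)%R && (q.2 <= Num.sqrt q.1)%R
  then (expR (- m * q.2 ^+ 2) * q.2 ^+ (d - 2))%:E else 0.
have mK : measurable_fun setT K.
  apply: measurable_fun_ifT => //.
    apply: measurable_and; apply: measurable_fun_ler => //.
    exact: (measurableT_comp measurable_sqrt).
  apply/measurable_EFinP; apply: measurable_funM; last exact: measurable_funX.
  apply: (measurableT_comp (@measurable_expR R)).
  by apply: measurable_funM => //; exact: measurable_funX.
rewrite (_ : inner_int d m = fun u => \int[lam]_s K (u, s)).
  apply: (measurable_fun_fubini_tonelli_F (m2 := lam) K) => //.
  move=> q; rewrite /K; case: ifPn => // /andP[q0 _].
  by rewrite lee_fin mulr_ge0 ?expR_ge0// exprn_ge0.
by apply/funext => u; rewrite /inner_int integral_itv_if.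
Qed.

Lemma halfpow_ge0 d (r : R) : (0 <= halfpow d r)%R.
Proof. exact: powR_ge0. Qed.

Lemma measurable_halfpow d : measurable_fun setT (@halfpow R d).
Proof. exact: measurable_powR. Qed.

Definition G_integrand d m (g : R -> \bar R) k (r rho : R) :=
  inner_int d m (Num.min rho (r - rho))%R *
          (g (r - rho)%R * (halfpow d (r - rho)%R)%:E) *
          (g rho * (halfpow d rho)%:E) * G_ d m g k rho.

(** The case [r = 0] of the recursion is subsumed, the interval being empty. *)
Lemma G_S d m (g : R -> \bar R) k (r : R) : G_ d m g k.+2 r =
  (\int[lam]_(rho in `]0%R, r[) G_integrand d m g k.+1 r rho)
    / (g r * (halfpow d r)%:E).
Proof.
rewrite [LHS]/=; case: ifPn => // /eqP ->.
by rewrite set_itvoo0 integral_set0 mul0e.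
Qed.

Lemma G_ge0 d m (g : R -> \bar R) k (r : R) :
  (forall s, 0 <= g s) -> 0 <= G_ d m g k r.
Proof.
move=> g0; elim: k r => [//|[//|k] IH] r.
rewrite G_S mule_ge0//; last by rewrite inve_ge0 mule_ge0// lee_fin halfpow_ge0.
by apply: integral_ge0 => rho _; rewrite !mule_ge0// ?inner_int_ge0 ?lee_fin ?halfpow_ge0.
Qed.

Lemma measurable_G_integrand d m (g : R -> \bar R) k :
  measurable_fun setT g -> measurable_fun setT (G_ d m g k) ->
  measurable_fun setT (fun q : R * R => G_integrand d m g k q.1 q.2).
Proof.
move=> mg mG.
have mdiff : measurable_fun setT (fun q : R * R => q.1 - q.2)%R.
  exact: measurable_funB.
apply: emeasurable_funM; last exact: (measurableT_comp mG).
apply: emeasurable_funM; last first.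
  apply: emeasurable_funM; first exact: (measurableT_comp mg).
  by apply/measurable_EFinP; exact: (measurableT_comp (@measurable_halfpow d)).
apply: emeasurable_funM; last first.
  apply: emeasurable_funM; first exact: (measurableT_comp mg mdiff).
  by apply/measurable_EFinP; exact: (measurableT_comp (@measurable_halfpow d) mdiff).
apply: (measurableT_comp (@measurable_inner_int d m)).
exact: measurable_minr.
Qed.

Lemma G_integrand_ge0 d m (g : R -> \bar R) k r rho :
  (forall s, 0 <= g s) -> 0 <= G_integrand d m g k r rho.
Proof.
move=> g0; rewrite !mule_ge0// ?inner_int_ge0 ?lee_fin ?halfpow_ge0//.
exact: G_ge0.
Qed.

Lemma measurable_G d m (g : R -> \bar R) k :
  measurable_fun setT g -> (forall s, 0 <= g s) ->
  measurable_fun setT (G_ d m g k).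
Proof.
move=> mg g0; elim: k => [|[|k] IH]; [exact: measurable_cst|exact: measurable_cst|].
pose K (q : R * R) := if (0 < q.2)%R && (q.2 < q.1)%R
  then G_integrand d m g k.+1 q.1 q.2 else 0.
have mK : measurable_fun setT K.
  apply: measurable_fun_ifT => //; last exact: measurable_G_integrand.
  by apply: measurable_and; exact: measurable_fun_ltr.
have K0 q : 0 <= K q by rewrite /K; case: ifPn => // _; exact: G_integrand_ge0.
rewrite (_ : G_ d m g k.+2 = fun r =>
    (\int[lam]_rho K (r, rho)) / (g r * (halfpow d r)%:E)); last first.
  by apply/funext => r; rewrite G_S integral_itv_if.
have mI : measurable_fun setT (fun r => \int[lam]_rho K (r, rho)).
  exact: (measurable_fun_fubini_tonelli_F (m2 := lam) K).
have mden : measurable_fun setT (fun r => (g r * (halfpow d r)%:E)^-1).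
  apply: (measurableT_comp measurable_inve); apply: emeasurable_funM => //.
  by apply/measurable_EFinP; exact: measurable_halfpow.
exact: (emeasurable_funM mI mden).
Qed.

(** This allows the profile to be modified on the negative numbers. *)
Lemma eq_G d m (g1 g2 : R -> \bar R) k r : (forall s, (0 <= s)%R -> g1 s = g2 s) ->
  (0 <= r)%R -> G_ d m g1 k r = G_ d m g2 k r.
Proof.
move=> g12; elim: k r => [//|[//|k] IH] r r0.
rewrite G_S [RHS]G_S (g12 r r0); apply: (congr1 (fun z => z / _)).
apply: eq_integral => rho; rewrite inE/= in_itv/= => /andP[rho0 rhor].
have rrho : (0 <= r - rho)%R by rewrite subr_ge0 ltW.
by rewrite /G_integrand !g12 ?IH ?(ltW rho0).
Qed.

End profile_measurability.

(** * Geometry of the lens *)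
Section geometry.
Context {R : rcfType}.

(** The distance from [x] to [y] when [|x| = r], [|y| = rho], and [y] lies at
    distance [s] from the axis of [x], on the same side as [x]. *)
Definition far_dist (r rho s : R) : R :=
  Num.sqrt ((r - Num.sqrt (rho ^+ 2 - s ^+ 2)) ^+ 2 + s ^+ 2).

(** With [t = sqrt (rho^2 - s^2)], the square of the distance is
    [(r - rho)^2 + 2 r (rho - t)], and [rho (rho - t) <= s^2]; hence it is at most
    [(r - rho)^2 + 2 u^2 (r - rho)]. The last three bounds follow from this one by
    inserting [u^2 <= rho], [u^2 <= r - rho], and by completing the square. *)
Lemma far_dist_bounds (r rho s u : R) : 0 < rho -> rho < r -> 0 <= s ->
  r * s ^+ 2 = u ^+ 2 * (rho * (r - rho)) -> u ^+ 2 <= rho -> u ^+ 2 <= r - rho ->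
  [/\ s < rho, far_dist r rho s < r, far_dist r rho s <= 2 * (r - rho) &
      far_dist r rho s + rho - r <= u ^+ 2].
Proof.
move=> rho0 rhor s0 sE urho urrho.
have r0 : 0 < r by exact: lt_trans rhor.
have v0 : 0 <= u ^+ 2 by exact: sqr_ge0.
move: (u ^+ 2) v0 sE urho urrho => v v0 sE vrho vrrho.
have d0 : 0 < r - rho by rewrite subr_gt0.
have s_lt : s < rho.
  rewrite -(@ltr_pXn2r _ 2) ?nnegrE ?(ltW rho0)// -(ltr_pM2l r0) sE.
  apply: (@le_lt_trans _ _ (rho * (rho * (r - rho)))).
    by apply: ler_wpM2r => //; rewrite mulr_ge0 ?ltW.
  rewrite mulrA -expr2 mulrC ltr_pM2r ?exprn_gt0//; lra.
have t2 : 0 <= rho ^+ 2 - s ^+ 2.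
  by rewrite subr_ge0 lerXn2r ?nnegrE ?(ltW rho0) ?(ltW s_lt).
have tE := sqr_sqrtr t2; have t0 := sqrtr_ge0 (rho ^+ 2 - s ^+ 2).
rewrite /far_dist; move: (Num.sqrt _) t0 tE => t t0 tE.
have t_le : t <= rho.
  rewrite -(@ler_pXn2r _ 2) ?nnegrE ?(ltW rho0)// tE lerBlDr lerDl; exact: sqr_ge0.
have key : r * (rho - t) <= v * (r - rho).
  rewrite -(ler_pM2l rho0).
  have -> : rho * (v * (r - rho)) = r * s ^+ 2 by rewrite sE; ring.
  have -> : s ^+ 2 = (rho - t) * (rho + t).
    by transitivity (rho ^+ 2 - t ^+ 2); [rewrite tE; ring | ring].
  rewrite mulrCA ler_pM2l// mulrC; apply: ler_wpM2l; lra.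
have D2 : (r - t) ^+ 2 + s ^+ 2 <= (r - rho) ^+ 2 + 2 * (v * (r - rho)).
  have -> : (r - t) ^+ 2 + s ^+ 2 = (r - rho) ^+ 2 + 2 * (r * (rho - t)).
    transitivity (r ^+ 2 - 2 * r * t + (t ^+ 2 + s ^+ 2)); first by ring.
    by rewrite tE; ring.
  by lra.
have D0 : 0 <= (r - t) ^+ 2 + s ^+ 2 by rewrite addr_ge0 ?sqr_ge0.
have DE := sqr_sqrtr D0; have D00 := sqrtr_ge0 ((r - t) ^+ 2 + s ^+ 2).
move: (Num.sqrt _) D00 DE => D D00 DE; rewrite -{}DE in D2.
split => //.
- rewrite -(@ltr_pXn2r _ 2) ?nnegrE ?(ltW r0)//; apply: le_lt_trans D2 _.
  have : v * (r - rho) <= rho * (r - rho) by apply: ler_wpM2r; lra.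
  have : 0 < rho ^+ 2 by exact: exprn_gt0.
  by rewrite !expr2; lra.
- have rhs0 : 0 <= 2 * (r - rho) by lra.
  rewrite -(@ler_pXn2r _ 2) ?nnegrE//; apply: le_trans D2 _.
  have : v * (r - rho) <= (r - rho) * (r - rho) by apply: ler_wpM2r; lra.
  by have : 0 <= (r - rho) ^+ 2 by [exact: sqr_ge0]; rewrite !expr2; lra.
- suff : D <= (r - rho) + v by lra.
  have rhs0 : 0 <= r - rho + v by lra.
  rewrite -(@ler_pXn2r _ 2) ?nnegrE//; apply: le_trans D2 _.
  by have : 0 <= v ^+ 2 by [exact: sqr_ge0]; rewrite !expr2; lra.
Qed.

End geometry.

(** * Integrals of functions of the two distances *)
Section bipolar_lower_bound.
Context {R : realType}.
Local Notation lam := (@lebesgue_measure R).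
Local Open Scope ereal_scope.

Lemma measurable_sqrt_sumsq : measurable_fun setT
  (fun q : R * R => Num.sqrt (q.1 ^+ 2 + q.2 ^+ 2)).
Proof.
by apply: (measurableT_comp measurable_sqrt); apply: measurable_funD;
  apply: measurable_funX.
Qed.

Lemma measurable_far_dist (r : R) : measurable_fun setT
  (fun q : R * R => far_dist r q.1 q.2).
Proof.
apply: (measurableT_comp measurable_sqrt); apply: measurable_funD; last first.
  exact: measurable_funX.
apply: measurable_funX; apply: measurable_funB => //.
apply: (measurableT_comp measurable_sqrt).
by apply: measurable_funB; apply: measurable_funX.
Qed.

(** The points of the half-space [t <= 0] are dropped, and the contraction from
    [t] to [rho] loses a factor [t / rho]; this is all that the bound gives away. *)
Lemma exists_bipolar_constant n : exists c : \bar R,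
  [/\ 0 <= c,
    c * (Gamma (n.+1%:R / 2))%:E = (2 * Num.sqrt pi ^+ n.+1)%:E &
    forall (x : Rn R n.+2) (Psi : R -> R -> \bar R),
      measurable_fun setT (fun q : R * R => Psi q.1 q.2) ->
      (forall a b, 0 <= Psi a b) ->
      c * \int[lam]_rho \int[lam]_s (if (0 < s)%R && (s < rho)%R
             then (s ^+ n)%:E * Psi rho (far_dist (enorm x) rho s) else 0) <=
      \int[leb n.+2]_y Psi (enorm y) (enorm (tsub x y))].
Proof.
have [c [c0 cG Hc]] := exists_radial_constant n (R := R).
exists c; split => // x Psi mPsi Psi0; set r := enorm x.
rewrite (integral_leb_bipolar x mPsi Psi0) -/r.
have mPsi2 d (T : measurableType d) (f1 f2 : T -> R) : measurable_fun setT f1 ->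
    measurable_fun setT f2 -> measurable_fun setT (fun z => Psi (f1 z) (f2 z)).
  move=> mf1 mf2; apply: (measurableT_comp mPsi (g := fun z => (f1 z, f2 z))).
  by apply/measurable_fun_pairP; split.
pose dist1 (t s : R) := Num.sqrt (t ^+ 2 + s ^+ 2).
pose dist2 (t s : R) := Num.sqrt ((r - t) ^+ 2 + s ^+ 2).
have mrt : measurable_fun setT (fun q : R * R => (r - q.1)%R).
  exact: measurable_funB.
have md1 : measurable_fun setT (fun q : R * R => dist1 q.1 q.2).
  exact: measurable_sqrt_sumsq.
have md2 : measurable_fun setT (fun q : R * R => dist2 q.1 q.2).
  apply: (measurableT_comp measurable_sqrt).
  by apply: measurable_funD; apply: measurable_funX.
(* q = (t, s): coordinate along the axis and distance to it *)
pose A (q : R * R) := if (0 < q.2)%R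
  then (q.2 ^+ n)%:E * Psi (dist1 q.1 q.2) (dist2 q.1 q.2) else 0.
have mpow : measurable_fun setT (fun q : R * R => (q.2 ^+ n)%:E).
  by apply/measurable_EFinP; exact: measurable_funX.
have mA : measurable_fun setT A.
  apply: measurable_fun_ifT => //; first exact: measurable_fun_ltr.
  by apply: emeasurable_funM => //; exact: mPsi2.
have A0 q : 0 <= A q.
  by rewrite /A; case: ifPn => // q0; rewrite mule_ge0// lee_fin exprn_ge0// ltW.
have -> : \int[leb n.+2]_y Psi (enorm y) (enorm (tsub (vaxis n.+1 r) y)) =
    c * \int[lam]_s \int[lam]_t A (t, s).
  rewrite integral_leb_cons//; last first.
    apply: mPsi2; first exact: measurable_enorm.
    exact: (measurableT_comp (@measurable_enorm R _) (measurable_tsub _)).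
  have <- : \int[lam]_t \int[lam]_s A (t, s) = \int[lam]_s \int[lam]_t A (t, s).
    exact: fubini_tonelli.
  rewrite -ge0_integralZl//; last 2 first.
  - exact: (measurable_fun_fubini_tonelli_F (m2 := lam) A).
  - by move=> t _; exact: integral_ge0.
  apply: eq_integral => t _.
  rewrite -(Hc (fun s => Psi (dist1 t s) (dist2 t s))) //; last first.
    by apply: mPsi2; [exact: (measurableT_comp md1 (measurable_pair1 t)) |
                      exact: (measurableT_comp md2 (measurable_pair1 t))].
  apply: eq_integral => w _; rewrite enorm_cons; congr Psi.
  rewrite tsub_vadd /vaxis vscale_cons vadd_cons enorm_cons mulN1r; congr Num.sqrt.
  congr (_ + _)%R; rewrite !enorm_sqr.
  by apply: eq_bigr => i _; rewrite !tnth_mktuple; ring.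
(* q = (rho, s): distance to the origin and distance to the axis *)
pose B (q : R * R) := if (0 < q.2)%R && (q.2 < q.1)%R
  then (q.2 ^+ n)%:E * Psi q.1 (far_dist r q.1 q.2) else 0.
have mB : measurable_fun setT B.
  apply: measurable_fun_ifT => //.
    by apply: measurable_and; exact: measurable_fun_ltr.
  by apply: emeasurable_funM => //; apply: mPsi2 => //; exact: measurable_far_dist.
have B0 q : 0 <= B q.
  rewrite /B; case: ifPn => // /andP[q0 _].
  by rewrite mule_ge0// lee_fin exprn_ge0// ltW.
rewrite [X in c * X <= _](_ : _ = \int[lam]_s \int[lam]_rho B (rho, s)); last first.
  by rewrite -[RHS]fubini_tonelli.
apply: lee_wpmul2l => //.
apply: ge0_le_integral_nonmeas => s _; first exact: integral_ge0.
have [s0|s0] := ltP 0%R s; last first.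
  rewrite integral0_eq ?integral_ge0// => rho _.
  by rewrite /B/= ltNge s0.
have sn0 : (0 <= s ^+ n)%R by rewrite exprn_ge0// ltW.
pose phi rho := (s ^+ n)%:E * Psi rho (far_dist r rho s).
have mphi : measurable_fun setT phi.
  apply: emeasurable_funM => //; apply: mPsi2 => //.
  exact: (measurableT_comp (measurable_far_dist r) (measurable_pair2 s)).
have phi0 rho : 0 <= phi rho by rewrite mule_ge0.
have -> : \int[lam]_rho B (rho, s) =
    \int[lam]_rho (if (s < rho)%R then phi rho else 0).
  by apply: eq_integral => rho _; rewrite /B/= s0.
apply: le_trans (le_integral_hypotenuse s0 mphi phi0) _.
apply: ge0_le_integral_nonmeas => t _; case: ifPn => // t0.
rewrite /phi /far_dist sqr_sqrtr ?addr_ge0 ?sqr_ge0// addrK sqrtr_sqr.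
by rewrite gtr0_norm// /A/= s0.
Qed.

End bipolar_lower_bound.

(** * The estimate at fixed distance from the origin *)
Section one_step.
Context {R : realType}.
Local Notation lam := (@lebesgue_measure R).
Local Open Scope ereal_scope.

Lemma halfpowE n (x : R) : (0 <= x)%R -> halfpow n.+2 x = (Num.sqrt x ^+ n.+1)%R.
Proof.
move=> x0; rewrite /halfpow -powR12_sqrt// -powR_mulrn ?powR_ge0// -powRrM.
by congr (_ `^ _)%R; rewrite -[n.+2%:R]natr1 addrK mulrC.
Qed.

(** The integrand [f (x - y) * f y * G |y|], restricted to the lens, in terms of
    [r = |x|], [a = |y|] and [b = |x - y|]. *)
Definition conv_kernel (m : R) (g G : R -> \bar R) (r a b : R) : \bar R :=
  if (a < r)%R && (b < r)%R
  then (expR (- m * b))%:E * g b * ((expR (- m * a))%:E * g a) * G a else 0.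

Lemma conv_kernel_ge0 m (g G : R -> \bar R) r a b :
  (forall s, 0 <= g s) -> (forall s, 0 <= G s) -> 0 <= conv_kernel m g G r a b.
Proof.
move=> g0 G0; rewrite /conv_kernel; case: ifPn => // _.
by rewrite !mule_ge0// lee_fin expR_ge0.
Qed.

Lemma measurable_conv_kernel m (g G : R -> \bar R) r :
  measurable_fun setT g -> measurable_fun setT G ->
  measurable_fun setT (fun q : R * R => conv_kernel m g G r q.1 q.2).
Proof.
move=> mg mG.
have mexp (i : R * R -> R) : measurable_fun setT i ->
    measurable_fun setT (fun q => (expR (- m * i q))%:E).
  move=> mi; apply/measurable_EFinP; apply: (measurableT_comp (@measurable_expR R)).
  exact: measurable_funM.
apply: measurable_fun_ifT => //.
  by apply: measurable_and; exact: measurable_fun_ltr.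
apply: emeasurable_funM; last exact: (measurableT_comp mG).
apply: emeasurable_funM; apply: emeasurable_funM.
- exact: mexp.
- exact: (measurableT_comp mg).
- exact: mexp.
- exact: (measurableT_comp mg).
Qed.

(** Substitute [s = beta * u] with [beta^2 = rho (r - rho) / r]. On the range of
    the inner integral, [far_dist_bounds] bounds the kernel from below by
    [e^(- m r) e^(- m u^2) g (r - rho) / C3 * g rho * G rho]. *)
Lemma slice_lower_bound n m (g G : R -> \bar R) (C3 r rho : R) :
  (0 < m)%R -> (forall s, 0 <= g s) -> (forall s t, (s <= t)%R -> g t <= g s) ->
  (1 <= C3)%R -> (forall s, (0 < s)%R -> g s <= C3%:E * g (2 * s)%R) ->
  (forall s, 0 <= G s) -> measurable_fun setT g -> measurable_fun setT G ->
  (0 < rho)%R -> (rho < r)%R ->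
  (expR (- m * r) * C3^-1 * (halfpow n.+2 r)^-1)%:E *
    (inner_int n.+2 m (Num.min rho (r - rho))%R *
      (g (r - rho)%R * (halfpow n.+2 (r - rho)%R)%:E) *
      (g rho * (halfpow n.+2 rho)%:E) * G rho) <=
  \int[lam]_s (if (0 < s)%R && (s < rho)%R
     then (s ^+ n)%:E * conv_kernel m g G r rho (far_dist r rho s) else 0).
Proof.
move=> m0 g0 g_ni C31 g2 G0 mg mG rho0 rhor.
have r0 : (0 < r)%R by exact: lt_trans rhor.
have d0 : (0 < r - rho)%R by rewrite subr_gt0.
have C30 : (0 < C3)%R by exact: lt_le_trans C31.
pose beta := (Num.sqrt rho * Num.sqrt (r - rho) / Num.sqrt r)%R.
have beta0 : (0 < beta)%R by rewrite !mulr_gt0 ?invr_gt0 ?sqrtr_gt0.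
have betaE : (r * beta ^+ 2 = rho * (r - rho))%R.
  by rewrite /beta !exprMn exprVn !sqr_sqrtr ?ltW//; field; rewrite gt_eqF.
pose W := g (r - rho)%R * (g rho * G rho).
have W0 : 0 <= W by rewrite /W !mule_ge0.
pose kappa := (expR (- m * r) * C3^-1)%R.
have kappa0 : (0 <= kappa)%R by rewrite mulr_ge0 ?expR_ge0 ?invr_ge0 ?(ltW C30).
pose B (s : R) := if (0 < s)%R && (s < rho)%R
     then (s ^+ n)%:E * conv_kernel m g G r rho (far_dist r rho s) else 0.
have B0 s : 0 <= B s.
  rewrite /B; case: ifPn => // /andP[s0 _].
  by rewrite mule_ge0 ?conv_kernel_ge0// lee_fin exprn_ge0// ltW.
have mB : measurable_fun setT B.
  apply: measurable_fun_ifT => //.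
    by apply: measurable_and; exact: measurable_fun_ltr.
  apply: emeasurable_funM.
    by apply/measurable_EFinP; exact: measurable_funX.
  have mfar := measurableT_comp (measurable_far_dist r) (measurable_pair1 rho).
  have mp : measurable_fun setT (fun s : R => (rho, far_dist r rho s)).
    apply/measurable_fun_pairP; split; first exact: measurable_cst.
    exact: mfar.
  exact: (measurableT_comp (measurable_conv_kernel m r mg mG) mp).
have -> : \int[lam]_s B s = beta%:E * \int[lam]_u B (beta * u)%R.
  have dilB := lebesgue_integral_dilate beta0 mB B0.
  apply: etrans (congr1 (fun z => beta%:E * z) (esym dilB)).
  by rewrite muleA -EFinM divff ?mul1e// gt_eqF.
have -> : (kappa * (halfpow n.+2 r)^-1)%:E *
    (inner_int n.+2 m (Num.min rho (r - rho))%R *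
      (g (r - rho)%R * (halfpow n.+2 (r - rho)%R)%:E) *
      (g rho * (halfpow n.+2 rho)%:E) * G rho) =
    beta%:E * (inner_int n.+2 m (Num.min rho (r - rho))%R *
               ((kappa * beta ^+ n)%:E * W)).
  have -> : (kappa * (halfpow n.+2 r)^-1)%:E *
    (inner_int n.+2 m (Num.min rho (r - rho))%R *
      (g (r - rho)%R * (halfpow n.+2 (r - rho)%R)%:E) *
      (g rho * (halfpow n.+2 rho)%:E) * G rho) =
    ((kappa * (halfpow n.+2 r)^-1)%:E * (halfpow n.+2 (r - rho)%R)%:E *
      (halfpow n.+2 rho)%:E) * (inner_int n.+2 m (Num.min rho (r - rho))%R * W).
    rewrite /W; set a := _%:E; set b := inner_int _ _ _; set e := g _.
    set i := (halfpow _ _)%:E; set j := g _; set k := (halfpow _ _)%:E.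
    set z := G _; rewrite !muleA.
    by rewrite [LHS](ACl (1*4*6*2*3*5*7)%AC).
  rewrite [X in _ = _ * X]muleCA [RHS]muleA -!EFinM; congr (_%:E * _).
  rewrite !halfpowE ?(ltW r0) ?(ltW d0) ?(ltW rho0)//.
  rewrite [RHS]mulrCA -exprS /beta !exprMn exprVn; ring.
apply: lee_wpmul2l; first by rewrite lee_fin ltW.
have mf : measurable_fun setT
    (fun s : R => (expR (- m * s ^+ 2) * s ^+ (n.+2 - 2))%:E).
  apply/measurable_EFinP; apply: measurable_funM; last exact: measurable_funX.
  apply: (measurableT_comp (@measurable_expR R)).
  by apply: measurable_funM => //; exact: measurable_funX.
have f0 (s : R) : (0 < s)%R -> (0 <= expR (- m * s ^+ 2) * s ^+ (n.+2 - 2))%R.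
  by move=> s0; rewrite mulr_ge0 ?expR_ge0// exprn_ge0// ltW.
rewrite /inner_int -integral_itv_obnd_cbnd; last exact: measurable_funTS.
rewrite -ge0_integralZr//; last 3 first.
- exact: measurable_funTS.
- by move=> s /=; rewrite in_itv/= => /andP[s0 _]; rewrite lee_fin f0.
- by rewrite mule_ge0// lee_fin mulr_ge0// exprn_ge0// ltW.
rewrite integral_itv_if; apply: ge0_le_integral_nonmeas => u _.
  case: ifPn => //; rewrite in_itv/= => /andP[u0 _].
  by rewrite !mule_ge0// lee_fin ?f0// mulr_ge0// exprn_ge0// ltW.
rewrite in_itv/=; case: ifPn => // /andP[u0 umin].
have u2 : (u ^+ 2 <= Num.min rho (r - rho))%R.
  have min0 : (0 <= Num.min rho (r - rho))%R by rewrite le_min !ltW.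
  by rewrite -(sqr_sqrtr min0) lerXn2r// nnegrE ?sqrtr_ge0// ltW.
move: u2; rewrite le_min => /andP[u2rho u2d].
have bu0 : (0 < beta * u)%R by exact: mulr_gt0.
have buE : (r * (beta * u) ^+ 2 = u ^+ 2 * (rho * (r - rho)))%R.
  by rewrite -betaE; ring.
have [bu_rho D_r D_2 D_u] := far_dist_bounds rho0 rhor (ltW bu0) buE u2rho u2d.
rewrite /B bu0 bu_rho /= /conv_kernel rhor D_r/=.
move: (far_dist _ _ _) D_r D_2 D_u => D D_r D_2 D_u.
have gD : C3^-1%:E * g (r - rho)%R <= g D.
  apply: (@le_trans _ _ (C3^-1%:E * (C3%:E * g D))).
    apply: lee_wpmul2l; first by rewrite lee_fin invr_ge0 ltW.
    apply: (le_trans (g2 _ d0)); apply: lee_wpmul2l; first by rewrite lee_fin ltW.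
    exact: g_ni.
  by rewrite muleA -EFinM mulVf ?mul1e// gt_eqF.
have expD : (expR (- m * u ^+ 2) * expR (- m * r) <= expR (- m * D) * expR (- m * rho))%R.
  rewrite -!expRD ler_expR -!mulrDr !mulNr lerN2 ler_pM2l//; lra.
rewrite subSS subSS subn0.
have -> : (expR (- m * u ^+ 2) * u ^+ n)%:E * ((kappa * beta ^+ n)%:E * W) =
  ((beta * u) ^+ n)%:E * ((expR (- m * u ^+ 2) * expR (- m * r))%:E *
   (C3^-1%:E * g (r - rho)%R) * (g rho * G rho)).
  rewrite /W /kappa [RHS]muleA; move: (g rho * G rho) => z.
  rewrite !muleA -!EFinM; congr (_%:E * _ * _).
  by rewrite (exprMn _ beta); ring.
have -> : (expR (- m * D))%:E * g D * ((expR (- m * rho))%:E * g rho) * G rho =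
  (expR (- m * D) * expR (- m * rho))%:E * g D * (g rho * G rho).
  rewrite EFinM !muleA; congr (_ * _ * _).
  by rewrite -!muleA; congr (_ * _); rewrite muleC.
apply: lee_wpmul2l; first by rewrite lee_fin exprn_ge0// ltW.
apply: lee_wpmul2r; first by rewrite mule_ge0.
apply: lee_pmul.
- by rewrite lee_fin mulr_ge0 ?expR_ge0.
- by rewrite mule_ge0// lee_fin invr_ge0 ltW.
- by rewrite lee_fin.
- exact: gD.
Qed.

End one_step.

(** * The induction *)
Section induction_step.
Context {R : realType}.
Local Notation lam := (@lebesgue_measure R).
Local Open Scope ereal_scope.

(** The factor [e^(- m r)] and the power of [r] in [slice_lower_bound] are cleared
    by the division by [f x]. An infinite [g r] is harmless: the quotient defining
    [G_] is then zero. *)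
Lemma exists_step_constant n : exists c : \bar R,
  [/\ 0 <= c,
    c * (Gamma (n.+1%:R / 2))%:E = (2 * Num.sqrt pi ^+ n.+1)%:E &
    forall (f : Rn R n.+2 -> \bar R) (m C3 : R) (g : R -> \bar R) k (x : Rn R n.+2),
      (forall y, f y = (expR (- m * enorm y))%:E * g (enorm y)) ->
      (0 < m)%R -> (forall s, 0 < g s) ->
      (forall s t, (s <= t)%R -> g t <= g s) ->
      (1 <= C3)%R -> (forall s, (0 < s)%R -> g s <= C3%:E * g (2 * s)%R) ->
      c * C3^-1%:E * G_ n.+2 m g k.+2 (enorm x) <=
      (\int[leb n.+2]_(y in lens x)
         (f (tsub x y) * f y * G_ n.+2 m g k.+1 (enorm y))) / f x].
Proof.
have [c [c0 cG Hc]] := exists_bipolar_constant n (R := R).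
exists c; split => // f m C3 g k x fE m0 g_gt0 g_ni C31 g2.
have g0 s : 0 <= g s by exact: ltW.
have mg := nonincreasing_emeasurable g_ni.
set r := enorm x; set Gk := G_ n.+2 m g k.+1.
have Gk0 s : 0 <= Gk s by exact: G_ge0.
have mGk : measurable_fun setT Gk by exact: measurable_G.
have f0 y : 0 <= f y by rewrite fE mule_ge0// lee_fin expR_ge0.
have C30 : (0 < C3)%R by exact: lt_le_trans C31.
set J := \int[leb n.+2]_(y in lens x) _.
have J0 : 0 <= J by apply: integral_ge0 => y _; rewrite !mule_ge0.
have [r0|] := ltP 0%R r; last first.
  rewrite le_eqVlt ltNge enorm_ge0 orbF => /eqP ->.
  by rewrite [G_ _ _ _ _ _]/= eqxx mule0 mule_ge0// inve_ge0.
set K := \int[lam]_(rho in `]0%R, r[) G_integrand n.+2 m g k.+1 r rho.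
pose kappa := (expR (- m * r) * C3^-1 * (halfpow n.+2 r)^-1)%R.
have h0 : (0 < halfpow n.+2 r)%R by exact: powR_gt0.
have kappa0 : (0 <= kappa)%R.
  by rewrite !mulr_ge0 ?expR_ge0 ?invr_ge0 ?(ltW C30) ?(ltW h0).
have JK : c * (kappa%:E * K) <= J.
  have -> : J = \int[leb n.+2]_y conv_kernel m g Gk r (enorm y) (enorm (tsub x y)).
    rewrite /J integral_mkcond; apply: eq_integral => y _.
    rewrite patchE /conv_kernel.
    have -> : (y \in lens x) = (enorm y < r)%R && (enorm (tsub x y) < r)%R.
      by apply/idP/andP; rewrite inE.
    by rewrite !fE.
  apply: le_trans (Hc x _ (measurable_conv_kernel m r mg mGk) _); last first.
    by move=> a b; exact: conv_kernel_ge0.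
  apply: lee_wpmul2l => //; rewrite /K -ge0_integralZl//; last 2 first.
  - apply: measurable_funTS.
    exact: (measurableT_comp (measurable_G_integrand mg mGk) (measurable_pair1 r)).
  - by move=> rho _; exact: G_integrand_ge0.
  rewrite integral_itv_if; apply: ge0_le_integral_nonmeas => rho _.
    by case: ifPn => // _; rewrite mule_ge0 ?G_integrand_ge0.
  rewrite in_itv/=; case: ifPn => [/andP[rho0 rhor]|_]; last first.
    apply: integral_ge0 => s _; case: ifPn => // /andP[s0 _].
    by rewrite mule_ge0 ?conv_kernel_ge0// lee_fin exprn_ge0// ltW.
  exact: slice_lower_bound.
rewrite G_S -/K fE -/r; apply: le_trans (lee_wpmul2r _ JK); last first.
  by rewrite inve_ge0 mule_ge0// lee_fin expR_ge0.
have := g_gt0 r; case: (g r) => [q| |]// q0; last first.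
  rewrite gt0_mulye ?lte_fin// invey !mule0.
  rewrite !mule_ge0// ?lee_fin//; last first.
    by rewrite inve_ge0 mule_ge0// ?lee_fin ?expR_ge0.
  by apply: integral_ge0 => rho _; exact: G_integrand_ge0.
rewrite lte_fin in q0; have e0 := expR_gt0 (- m * r)%R.
rewrite -!EFinM !inver !gt_eqF ?mulr_gt0//.
rewrite [X in _ <= X](_ : _ = c * K * (kappa * (expR (- m * r) * q)^-1)%:E); last first.
  by rewrite -!muleA; congr (c * _); rewrite EFinM muleCA !muleA.
rewrite [X in X <= _](_ : _ = c * K * (C3^-1 * (q * halfpow n.+2 r)^-1)%:E); last first.
  by rewrite -!muleA; congr (c * _); rewrite EFinM muleCA.
rewrite le_eqVlt; apply/orP; left; apply/eqP; congr (_ * _%:E).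
by rewrite /kappa; field; rewrite !gt_eqF.
Qed.

Lemma measurable_lens n (x : Rn R n) : measurable (lens x).
Proof.
have mb : measurable_fun setT
    (fun y : Rn R n => (enorm y < enorm x)%R && (enorm (tsub x y) < enorm x)%R).
  apply: measurable_and; apply: measurable_fun_ltr => //.
    exact: measurable_enorm.
  exact: (measurableT_comp (@measurable_enorm R n) (measurable_tsub x)).
have := mb measurableT [set true] I; rewrite setTI.
by congr measurable; apply/seteqP; split => y /= /andP.
Qed.

(** With [c = 2 pi^((n+1)/2) / Gamma((n+1)/2)], the claim reduces to
    [2^n <= pi^n]. *)
Lemma M4_le n (C3 : R) (c : \bar R) : (1 <= C3)%R -> 0 <= c ->
  c * (Gamma (n.+1%:R / 2))%:E = (2 * Num.sqrt pi ^+ n.+1)%:E ->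
  (M4 n.+2 C3)%:E <= c * C3^-1%:E.
Proof.
move=> C31 c0 cG; have C30 : (0 < C3)%R by exact: lt_le_trans C31.
have p0 : (0 < pi :> R)%R by exact: pi_gt0.
have pos : (0 < 2 * Num.sqrt pi ^+ n.+1 :> R)%R.
  by rewrite mulr_gt0// exprn_gt0// sqrtr_gt0.
have G_gt0 : (0 < Gamma (n.+1%:R / 2) :> R)%R.
  rewrite ltNge; apply/negP => G0.
  have : c * (Gamma (n.+1%:R / 2))%:E <= 0 by rewrite mule_ge0_le0.
  by rewrite cG lee_fin leNgt pos.
case: c c0 cG => [c| |]// c0; last by rewrite gt0_mulye ?lte_fin.
rewrite -EFinM => -[cG]; rewrite -EFinM lee_fin /M4 ge_min; apply/orP; right.
have -> : ((n.+2%:R - 1) / 2 = n.+1%:R / 2 :> R)%R by rewrite -[n.+2%:R]natr1 addrK.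
rewrite subn1/= ler_pdivrMr; last by rewrite !mulr_gt0// powR_gt0.
have -> : (c / C3 * (C3 * pi `^ ((n.+2%:R - 3) / 2) * Gamma (n.+1%:R / 2)) =
    pi `^ ((n.+2%:R - 3) / 2) * (c * Gamma (n.+1%:R / 2)))%R.
  by field; rewrite gt_eqF.
rewrite cG mulrCA exprS ler_pM2l// -powR12_sqrt ?(ltW p0)//.
rewrite -(powR_mulrn n.+1 (powR_ge0 pi 2^-1)).
rewrite -powRrM -powRD; last by apply/implyP => _; rewrite gt_eqF.
have -> : ((n.+2%:R - 3) / 2 + 2^-1 * n.+1%:R = n%:R :> R)%R.
  by rewrite -[n.+2%:R]natr1 -[n.+1%:R]natr1; field.
rewrite powR_mulrn ?(ltW p0)// lerXn2r ?nnegrE ?(ltW p0)//; exact: pi_ge2.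
Qed.

End induction_step.

Theorem theorem3p3 (R : realType) (d : nat) (hd : (2 <= d)%N)
    (f : Rn R d -> \bar R) (m : R) (g : R -> \bar R) (C3 : R)
    (hB : assumptionB f m g C3) (n : nat) (hn : (1 <= n)%N) (x : Rn R d) :
  ((M4 d C3 ^+ (n - 1))%:E * G_ d m g n (enorm x) <= g_ f n x)%E.
Proof.
case: d hd f hB x => [//|[//|d]] _ f [[_ f0 _] [fE [m0 [g_gt0 [g_ni [C31 g2]]]]]] x.
case: n hn => [//|n] _; rewrite subSS subn0.
have [c [c0 cG Hc]] := exists_step_constant d (R := R).
have Mc := M4_le C31 c0 cG.
have M0 : (0 <= M4 d.+2 C3).
  rewrite le_min ler01/= divr_ge0 ?exprn_ge0// !mulr_ge0 ?powR_ge0//.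
    by rewrite (le_trans ler01).
  by apply: Rintegral_ge0 => t _; rewrite mulr_ge0 ?powR_ge0 ?expR_ge0.
(* monotone on the whole line, hence measurable *)
pose gg (s : R) := g (Num.max 0 s).
have ggE s : (0 <= s)%R -> g s = gg s by move=> s0; rewrite /gg max_r.
have gg_gt0 s : (0 < gg s)%E by apply: g_gt0; rewrite le_max lexx.
have gg_ni s t : (s <= t)%R -> (gg t <= gg s)%E.
  move=> st; apply: g_ni; first by rewrite le_max lexx.
  by rewrite ge_max !le_max lexx st orbT.
have gg2 s : (0 < s)%R -> (gg s <= C3%:E * gg (2 * s)%R)%E.
  by move=> s0; rewrite -!ggE ?mulr_ge0 ?(ltW s0)//; exact: g2.
have ffE y : f y = ((expR (- m * enorm y))%:E * gg (enorm y))%E.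
  by rewrite fE ggE ?enorm_ge0.
have mgg := nonincreasing_emeasurable gg_ni.
have mf : measurable_fun setT f.
  rewrite (_ : f = fun y => ((expR (- m * enorm y))%:E * gg (enorm y))%E); last first.
    exact/funext.
  apply: emeasurable_funM; last exact: (measurableT_comp mgg (@measurable_enorm R _)).
  apply/measurable_EFinP; apply: (measurableT_comp (@measurable_expR R)).
  by apply: measurable_funM => //; exact: measurable_enorm.
rewrite (eq_G _ _ _ ggE)//; last exact: enorm_ge0.
have GG0 k r : (0 <= G_ d.+2 m gg k r)%E by apply: G_ge0 => s; exact: ltW.
elim: n x => [|n IH] x; first by rewrite expr0 mul1e.
have f_ge0 y : (0 <= f y)%E by exact: f0.
pose I := (\int[leb d.+2]_(y in lens x)
  (f (tsub x y) * f y * G_ d.+2 m gg n.+1 (enorm y)))%E.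
have step : (((M4 d.+2 C3 ^+ n)%:E * I) / f x <= g_ f n.+2 x)%E.
  rewrite [g_ f n.+2 x]/=; apply: lee_wpmul2r; first by rewrite inve_ge0.
  rewrite /I -ge0_integralZl//; last 4 first.
  - exact: measurable_lens.
  - apply: measurable_funTS; apply: emeasurable_funM; last first.
      apply: (measurableT_comp _ (@measurable_enorm R _)).
      by apply: measurable_G => // s; exact: ltW.
    apply: emeasurable_funM => //.
    exact: (measurableT_comp mf (measurable_tsub _)).
  - by move=> y _; rewrite !mule_ge0.
  - by rewrite lee_fin exprn_ge0.
  apply: ge0_le_integral_nonmeas => y _; rewrite muleCA.
    by rewrite !mule_ge0// lee_fin exprn_ge0.
  by apply: lee_wpmul2l; [rewrite mule_ge0|exact: IH].
apply: le_trans step; rewrite exprSr EFinM -!muleA; apply: lee_wpmul2l.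
  by rewrite lee_fin exprn_ge0.
apply: le_trans (Hc f m C3 gg n x ffE m0 gg_gt0 gg_ni C31 gg2).
exact: lee_wpmul2r.
Qed.
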